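(* There is an algorithm that, given a 2-SAT formula $\Phi$ (a CNF formula each of whose clauses has at most two literals) and an integer $k$, decides whether there is a set of at most $k$ clauses of $\Phi$ whose deletion makes $\Phi$ satisfiable, in time $O^*(4^k)$.
   Context: $O^*(\cdot)$ suppresses factors polynomial in the input size. *)

(* Defs.v *)
(* Model of computation: a unit-cost RAM with addition,
   truncated subtraction and indirect addressing (no multiplication),
   which is polynomially equivalent to Turing machines. *)
From Stdlib Require Import Arith List Lia.
Import ListNotations.

(* A literal is (polarity, variable): (true, v) = x_v, (false, v) = ~x_v. *)
Definition literal := (bool * nat)%type.
Definition clause := list literal.
Definition cnf := list clause.

Definition is_2cnf (F : cnf) : Prop := Forall (fun c => length c <= 2) F.

Definition lit_true (a : nat -> bool) (l : literal) : Prop := a (snd l) = fst l.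
Definition clause_sat (a : nat -> bool) (c : clause) : Prop := Exists (lit_true a) c.
Definition satisfiable (F : cnf) : Prop := exists a : nat -> bool, Forall (clause_sat a) F.

Definition delete_clauses (S : list nat) (F : cnf) : cnf :=
  map snd (filter (fun ic => negb (existsb (Nat.eqb (fst ic)) S))
                  (combine (seq 0 (length F)) F)).

Definition del_sat (F : cnf) (k : nat) : Prop :=
  exists S : list nat, NoDup S /\ Forall (fun i => i < length F) S /\
    length S <= k /\ satisfiable (delete_clauses S F).

Inductive instr : Type :=
| CONST (r n : nat)
| ADD (r a b : nat)
| SUB (r a b : nat)
| LOAD (r a : nat)
| STORE (a r : nat)
| JZ (r l : nat)
| JMP (l : nat)
| HALT.

Definition program := list instr.
Definition memory := nat -> nat.
Definition state := (nat * memory)%type.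

Definition upd (m : memory) (a v : nat) : memory :=
  fun x => if Nat.eqb x a then v else m x.

Definition halted (P : program) (s : state) : bool :=
  match nth_error P (fst s) with
  | None => true
  | Some HALT => true
  | Some _ => false
  end.

Definition step (P : program) (s : state) : state :=
  let (pc, m) := s in
  match nth_error P pc with
  | None => s
  | Some HALT => s
  | Some (CONST r n) => (S pc, upd m r n)
  | Some (ADD r a b) => (S pc, upd m r (m a + m b))
  | Some (SUB r a b) => (S pc, upd m r (m a - m b))
  | Some (LOAD r a) => (S pc, upd m r (m (m a)))
  | Some (STORE a r) => (S pc, upd m (m a) (m r))
  | Some (JZ r l) => if Nat.eqb (m r) 0 then (l, m) else (S pc, m)
  | Some (JMP l) => (l, m)
  end.

Fixpoint exec (P : program) (t : nat) (s : state) : state :=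
  match t with
  | 0 => s
  | S t' => exec P t' (step P s)
  end.

Definition init_mem (L : list nat) : memory := fun x => nth x L 0.

(* literal (b, v) is coded by 2v + 1 + [b] (always nonzero). *)
Definition enc_lit (l : literal) : nat := 2 * snd l + 1 + (if fst l then 1 else 0).
(* each clause of size <= 2 takes 3 cells: [size; lit1; lit2], padded with 0 *)
Definition enc_clause (c : clause) : list nat :=
  length c :: firstn 2 (map enc_lit c ++ [0; 0]).
Definition encode (F : cnf) (k : nat) : list nat :=
  k :: length F :: flat_map enc_clause F.

Definition bitlen (x : nat) : nat := S (Nat.log2 x).
Definition input_size (L : list nat) : nat := fold_right (fun x acc => bitlen x + acc) 0 L.

(* Main.v *)
(* A set A of literals is a cut of the implication graph, in which a clause
   (a or b) contributes the arcs -a -> b and -b -> a: the number of arcs leaving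
   the set of literals true under an assignment is twice the number of violated
   nonempty clauses (a unit clause a counts as (a or a)).

   The algorithm grows a consistent set S of literals, starting from the empty
   one, along with a lower bound r, initially 0, on the cuts containing S and
   avoiding -S.  If, for an undecided literal x, S + x or S + -x still admits a
   cut of value r, then the smallest such cut may replace S: by submodularity
   and skew symmetry every assignment extending S can be overwritten by it at no
   cost.  Otherwise one of x, -x is guessed, and the bound improves to r + 1.
   Since r is at most 2k along the branch of a solution, this branch is
   described by one of the 2 * 4^k words of 2k + 1 bits, and the algorithm tries
   them all, each in polynomial time.

   Instead of a flow the algorithm keeps the residual graph.  Reversing a path
   from S to -S decreases every cut containing S and avoiding -S by exactly
   one, so each such cut has value r plus the number of its leaving arcs in the
   residual graph after r reversals.  A cut of value r exists exactly when no
   path is left, and these cuts are then the closed sets. *)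
Require Import Defs.
From Stdlib Require Import Arith List Lia Bool Wf_nat Classical.
Import ListNotations.

(** * A structured language *)

(** The guess word is fixed before an attempt starts, so an attempt is a plain loop without
    recursion, and the exponential factor is just the number of words. Soundness owes nothing to
    optimality: whatever the word, an attempt ends with a complete assignment whose violated arcs
    are recounted in the original graph, so acceptance always exhibits a deletion set. Submodularity
    and persistency serve only to show that an accepting word exists. The predicate [wins] describes
    a run by sets and cuts alone; the existence is proved for it, away from the program, which is
    then shown to follow [wins]. Paths are avoided as objects: being reached is expressed as lying
    in every closed set that contains the sources, and a path appears only as a chain of parent
    pointers while it is reversed. The program is verified in a small language with arrays, whose
    compiled code takes a bounded number of RAM steps per unit of cost. Empty clauses have no arcs;
    each of them adds 2 to the cut separately. *)

Inductive expr : Type :=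
| EC (n : nat)
| EG (a : nat) (e : expr)
| EA (e1 e2 : expr)
| ES (e1 e2 : expr).

Inductive cmd : Type :=
| Skip
| Put (a : nat) (i v : expr)
| Seq (c1 c2 : cmd)
| If (e : expr) (c1 c2 : cmd)
| While (e : expr) (c : cmd).

Declare Scope cmd_scope.
Delimit Scope cmd_scope with cmd.
Bind Scope cmd_scope with cmd.
Notation "c ;; d" := (Seq c d) (at level 90, right associativity) : cmd_scope.

(** Indexed by the array, then by the cell; a scalar register is cell 0 of an array of its own. *)
Definition env := nat -> nat -> nat.

Definition put (s : env) (a i v b j : nat) : nat :=
  if (b =? a) && (j =? i) then v else s b j.

Arguments put s a i v b j /.

Fixpoint eval (s : env) (e : expr) : nat :=
  match e with
  | EC n => n
  | EG a e => s a (eval s e)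
  | EA e1 e2 => eval s e1 + eval s e2
  | ES e1 e2 => eval s e1 - eval s e2
  end.

(** Only assignments and tests are charged. Evaluating an expression takes a number of instructions
    fixed by the program, which [slowdown] absorbs. *)
Inductive ev : cmd -> env -> nat -> env -> Prop :=
| ev_skip s : ev Skip s 0 s
| ev_put a i v s : ev (Put a i v) s 1 (put s a (eval s i) (eval s v))
| ev_seq c1 c2 s t1 s1 t2 s2 :
    ev c1 s t1 s1 -> ev c2 s1 t2 s2 -> ev (Seq c1 c2) s (t1 + t2) s2
| ev_if_true e c1 c2 s t s' :
    eval s e <> 0 -> ev c1 s t s' -> ev (If e c1 c2) s (S t) s'
| ev_if_false e c1 c2 s t s' :
    eval s e = 0 -> ev c2 s t s' -> ev (If e c1 c2) s (S t) s'
| ev_while_false e c s : eval s e = 0 -> ev (While e c) s 1 s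
| ev_while_true e c s t1 s1 t2 s2 :
    eval s e <> 0 -> ev c s t1 s1 -> ev (While e c) s1 t2 s2 ->
    ev (While e c) s (S (t1 + t2)) s2.

(** * Compilation to the RAM *)

(* Arrays 0 and 1 are the input cells congruent to 0 and 1 modulo 3.  The
   cells congruent to 2 hold the clause sizes; these are redundant, since
   literal codes are nonzero, so all other arrays are interleaved there.
   Array 63 is the evaluation stack. *)
Definition addr (a i : nat) : nat :=
  if a <? 2 then 3 * i + a else 3 * (64 * i + a) + 2.

Definition tmp (d : nat) : nat := addr 63 d.

(** Without multiplication, the factor 3 takes two additions and the factor 64 six doublings; slot
    [S d] of the stack is scratch space. *)
Definition caddr (a d : nat) : list instr :=
  [ADD (tmp (S d)) (tmp d) (tmp d); ADD (tmp d) (tmp (S d)) (tmp d)] ++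
  (if a <? 2 then [] else repeat (ADD (tmp d) (tmp d) (tmp d)) 6) ++
  [CONST (tmp (S d)) (if a <? 2 then a else 3 * a + 2);
   ADD (tmp d) (tmp d) (tmp (S d))].

Arguments tmp : simpl never.
Fixpoint cexpr (d : nat) (e : expr) : list instr :=
  match e with
  | EC n => [CONST (tmp d) n]
  | EG a e => cexpr d e ++ caddr a d ++ [LOAD (tmp d) (tmp d)]
  | EA e1 e2 => cexpr d e1 ++ cexpr (S d) e2 ++ [ADD (tmp d) (tmp d) (tmp (S d))]
  | ES e1 e2 => cexpr d e1 ++ cexpr (S d) e2 ++ [SUB (tmp d) (tmp d) (tmp (S d))]
  end.

(** Jump targets are absolute, hence the parameter [p], the address at which the code is placed. *)
Fixpoint comp (p : nat) (c : cmd) : list instr :=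
  match c with
  | Skip => []
  | Put a i v => cexpr 0 i ++ caddr a 0 ++ cexpr 1 v ++ [STORE (tmp 0) (tmp 1)]
  | Seq c1 c2 => let l1 := comp p c1 in l1 ++ comp (p + length l1) c2
  | If e c1 c2 =>
      let l0 := cexpr 0 e in
      let l1 := comp (p + length l0 + 1) c1 in
      let q := p + length l0 + 1 + length l1 + 1 in
      let l2 := comp q c2 in
      l0 ++ [JZ (tmp 0) q] ++ l1 ++ [JMP (q + length l2)] ++ l2
  | While e c =>
      let l0 := cexpr 0 e in
      let l1 := comp (p + length l0 + 1) c in
      l0 ++ [JZ (tmp 0) (p + length l0 + 1 + length l1 + 1)] ++ l1 ++ [JMP p]
  end.

Fixpoint wf_expr (e : expr) : bool :=
  match e with
  | EC _ => true
  | EG a e => (a <? 63) && wf_expr e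
  | EA e1 e2 | ES e1 e2 => wf_expr e1 && wf_expr e2
  end.

Fixpoint wf (c : cmd) : bool :=
  match c with
  | Skip => true
  | Put a i v => (2 <=? a) && (a <? 63) && wf_expr i && wf_expr v
  | Seq c1 c2 => wf c1 && wf c2
  | If e c1 c2 => wf_expr e && wf c1 && wf c2
  | While e c => wf_expr e && wf c
  end.

(** A number of RAM steps that covers each unit of cost. Adding the factors of subcommands, rather
    than taking maxima, keeps the bounds elementary and still gives a constant of the program. *)
Fixpoint slowdown (c : cmd) : nat :=
  match c with
  | Skip => 0
  | Put _ _ _ => length (comp 0 c)
  | Seq c1 c2 => slowdown c1 + slowdown c2
  | If e c1 c2 => length (cexpr 0 e) + 2 + slowdown c1 + slowdown c2
  | While e c => length (cexpr 0 e) + 2 + slowdown c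
  end.

Definition rep (m : memory) (s : env) : Prop :=
  forall a i, a < 63 -> m (addr a i) = s a i.

Lemma addr_inj a i b j :
  a < 64 -> b < 64 -> addr a i = addr b j -> a = b /\ i = j.
Proof.
  unfold addr; intros Ha Hb.
  destruct (Nat.ltb_spec a 2), (Nat.ltb_spec b 2); lia.
Qed.

Lemma tmp_inj d d' : tmp d = tmp d' -> d = d'.
Proof. intros H; apply addr_inj in H; lia. Qed.

Lemma tmp_addr a i d : a < 63 -> addr a i <> tmp d.
Proof. intros Ha H; apply addr_inj in H; lia. Qed.

Lemma upd_eq m a v : upd m a v a = v.
Proof. unfold upd; now rewrite Nat.eqb_refl. Qed.

Lemma upd_neq m a v x : x <> a -> upd m a v x = m x.
Proof. unfold upd; intros H; apply Nat.eqb_neq in H; now rewrite H. Qed.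

Lemma rep_tmp m s d v : rep m s -> rep (upd m (tmp d) v) s.
Proof.
  intros H a i Ha; rewrite upd_neq by now apply tmp_addr.
  now apply H.
Qed.

Definition effect (m : memory) (x : instr) : memory :=
  match x with
  | CONST r n => upd m r n
  | ADD r a b => upd m r (m a + m b)
  | SUB r a b => upd m r (m a - m b)
  | LOAD r a => upd m r (m (m a))
  | STORE a r => upd m (m a) (m r)
  | _ => m
  end.

Definition straight (x : instr) : bool :=
  match x with JZ _ _ | JMP _ | HALT => false | _ => true end.

Definition effects (l : list instr) (m : memory) : memory := fold_left effect l m.

Definition code_at (P : program) (p : nat) (l : list instr) : Prop :=
  forall i x, nth_error l i = Some x -> nth_error P (p + i) = Some x.

Lemma code_at_app P p l1 l2 :
  code_at P p (l1 ++ l2) -> code_at P p l1 /\ code_at P (p + length l1) l2.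
Proof.
  intros H; split; intros i x Hx.
  - apply H; rewrite nth_error_app1; auto.
    apply nth_error_Some; congruence.
  - rewrite <- Nat.add_assoc; apply H.
    rewrite nth_error_app2 by lia.
    now replace (length l1 + i - length l1) with i by lia.
Qed.

Lemma code_at_cons P p x l :
  code_at P p (x :: l) -> nth_error P p = Some x /\ code_at P (p + 1) l.
Proof.
  intros H; split.
  - rewrite <- (Nat.add_0_r p); now apply H.
  - intros i y Hy; replace (p + 1 + i) with (p + S i) by lia; now apply H.
Qed.

Lemma exec_add P t1 t2 s : exec P (t1 + t2) s = exec P t2 (exec P t1 s).
Proof. revert s; induction t1; simpl; auto. Qed.

Lemma exec_straight P p l m :
  code_at P p l -> forallb straight l = true ->
  exec P (length l) (p, m) = (p + length l, effects l m).
Proof.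
  revert p m; induction l as [|x l IH]; intros p m Hc Hs; simpl.
  - now rewrite Nat.add_0_r.
  - apply code_at_cons in Hc as [Hx Hl].
    apply andb_true_iff in Hs as [Hs1 Hs2].
    rewrite Hx, <- Nat.add_succ_comm; rewrite Nat.add_1_r in Hl.
    destruct x; try discriminate; simpl; now rewrite IH.
Qed.

Lemma effects_app l1 l2 m : effects (l1 ++ l2) m = effects l2 (effects l1 m).
Proof. apply fold_left_app. Qed.

Lemma straight_caddr a d : forallb straight (caddr a d) = true.
Proof. unfold caddr; now destruct (a <? 2). Qed.

Lemma effects_caddr a d m s i :
  rep m s -> m (tmp d) = i ->
  let m' := effects (caddr a d) m in
  rep m' s /\ m' (tmp d) = addr a i /\ (forall d', d' < d -> m' (tmp d') = m (tmp d')).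
Proof.
  intros Hr Hi m'.
  assert (Hd : tmp d <> tmp (S d)) by (intros E; apply tmp_inj in E; lia).
  assert (Hlt : forall d', d' < d -> tmp d' <> tmp d /\ tmp d' <> tmp (S d))
    by (intros d' Hd'; split; intros E; apply tmp_inj in E; lia).
  subst m'; unfold caddr, addr.
  destruct (a <? 2); simpl; repeat split; repeat apply rep_tmp; auto;
    try (intros d' Hd'; destruct (Hlt d' Hd'); now rewrite !upd_neq by auto);
    repeat (rewrite ?upd_eq; rewrite ?(upd_neq _ (tmp (S d)) _ (tmp d)) by auto;
            rewrite ?(upd_neq _ (tmp d) _ (tmp (S d))) by auto); subst i; lia.
Qed.

Opaque caddr.

Lemma straight_cexpr e : forall d, forallb straight (cexpr d e) = true.
Proof.
  induction e; intros d; simpl; auto.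
  - now rewrite forallb_app, IHe, forallb_app, straight_caddr.
  - now rewrite !forallb_app, IHe1, IHe2.
  - now rewrite !forallb_app, IHe1, IHe2.
Qed.

(** The last clause, preservation of the stack below [d], lets the first operand survive the
    evaluation of the second one. *)
Lemma effects_cexpr s e : forall d m,
  wf_expr e = true -> rep m s ->
  let m' := effects (cexpr d e) m in
  rep m' s /\ m' (tmp d) = eval s e /\ (forall d', d' < d -> m' (tmp d') = m (tmp d')).
Proof.
  assert (Hne : forall d d', d' <> d -> tmp d' <> tmp d)
    by (intros d d' H E; now apply tmp_inj in E).
  assert (Hlt : forall d d', d' < d -> tmp d' <> tmp d) by (intros; apply Hne; lia).
  induction e as [n|a e IH|e1 IH1 e2 IH2|e1 IH1 e2 IH2]; intros d m Hw Hr; simpl in *.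
  - repeat split; [now apply rep_tmp|now rewrite upd_eq|].
    intros; now rewrite upd_neq by auto.
  - apply andb_true_iff in Hw as [Ha Hw]; apply Nat.ltb_lt in Ha.
    rewrite !effects_app.
    destruct (IH d m Hw Hr) as (Hr1 & Hv1 & Hf1).
    destruct (effects_caddr a d _ s _ Hr1 Hv1) as (Hr2 & Hv2 & Hf2).
    cbv zeta in Hr2, Hv2, Hf2; simpl; repeat split.
    + now apply rep_tmp.
    + rewrite upd_eq, Hv2; now apply Hr2.
    + intros d' Hd'; rewrite upd_neq by auto; rewrite Hf2 by auto; auto.
  - apply andb_true_iff in Hw as [Hw1 Hw2]; rewrite !effects_app.
    destruct (IH1 d m Hw1 Hr) as (Hr1 & Hv1 & Hf1).
    destruct (IH2 (S d) _ Hw2 Hr1) as (Hr2 & Hv2 & Hf2).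
    simpl; repeat split.
    + now apply rep_tmp.
    + now rewrite upd_eq, Hv2, Hf2, Hv1 by lia.
    + intros d' Hd'; rewrite upd_neq by auto; rewrite Hf2 by lia; auto.
  - apply andb_true_iff in Hw as [Hw1 Hw2]; rewrite !effects_app.
    destruct (IH1 d m Hw1 Hr) as (Hr1 & Hv1 & Hf1).
    destruct (IH2 (S d) _ Hw2 Hr1) as (Hr2 & Hv2 & Hf2).
    simpl; repeat split.
    + now apply rep_tmp.
    + now rewrite upd_eq, Hv2, Hf2, Hv1 by lia.
    + intros d' Hd'; rewrite upd_neq by auto; rewrite Hf2 by lia; auto.
Qed.

Lemma exec_cexpr P p e m s :
  code_at P p (cexpr 0 e) -> wf_expr e = true -> rep m s ->
  exists m', exec P (length (cexpr 0 e)) (p, m) = (p + length (cexpr 0 e), m')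
    /\ rep m' s /\ m' (tmp 0) = eval s e.
Proof.
  intros Hc Hw Hr.
  destruct (effects_cexpr s e 0 m Hw Hr) as (Hr1 & Hv1 & _).
  eexists; split; [apply exec_straight; auto; apply straight_cexpr|auto].
Qed.

Lemma exec_test P p e m s q l :
  code_at P p (cexpr 0 e ++ JZ (tmp 0) q :: l) -> wf_expr e = true -> rep m s ->
  exists m', exec P (length (cexpr 0 e) + 1) (p, m) =
      (if eval s e =? 0 then q else p + length (cexpr 0 e) + 1, m') /\ rep m' s.
Proof.
  intros Hc Hw Hr; apply code_at_app in Hc as [Hc Hj].
  apply code_at_cons in Hj as [Hj _].
  destruct (exec_cexpr P p e m s Hc Hw Hr) as (m' & E & Hr' & Hv).
  exists m'; split; auto.
  rewrite exec_add, E; simpl; rewrite Hj, Hv.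
  destruct (eval s e =? 0); f_equal; lia.
Qed.

(** Induction on the evaluation rather than on the command: the remaining iterations of a loop are
    then covered by the hypothesis for the same code at the same address. *)
Lemma comp_correct c s t s' : ev c s t s' ->
  forall P p m, code_at P p (comp p c) -> wf c = true -> rep m s ->
  exists t' m', t' <= slowdown c * t /\
    exec P t' (p, m) = (p + length (comp p c), m') /\ rep m' s'.
Proof.
  induction 1 as [s|a i v s|c1 c2 s t1 s1 t2 s2 _ IH1 _ IH2
    |e c1 c2 s t s' He _ IH|e c1 c2 s t s' He _ IH|e c s He
    |e c s t1 s1 t2 s2 He _ IH1 _ IH2]; intros P p m Hc Hw Hr.
  - exists 0, m; simpl; rewrite Nat.add_0_r; auto.
  - exists (length (comp p (Put a i v))).
    assert (Hs : forallb straight (comp p (Put a i v)) = true)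
      by (simpl; now rewrite forallb_app, straight_cexpr, forallb_app, straight_caddr,
            forallb_app, straight_cexpr).
    eexists; split; [|split; [apply exec_straight; auto|]].
    { unfold slowdown; simpl; lia. }
    cbn [wf] in Hw; rewrite !andb_true_iff, Nat.leb_le, Nat.ltb_lt in Hw.
    destruct Hw as [[[Ha1 Ha2] Hi] Hv].
    simpl; rewrite !effects_app.
    destruct (effects_cexpr s i 0 m Hi Hr) as (Hr1 & Hv1 & _).
    destruct (effects_caddr a 0 _ s _ Hr1 Hv1) as (Hr2 & Hv2 & _).
    cbv zeta in Hr2, Hv2.
    destruct (effects_cexpr s v 1 _ Hv Hr2) as (Hr3 & Hv3 & Hf3).
    simpl; rewrite Hv3, Hf3, Hv2 by lia.
    intros b j Hb; unfold put.
    destruct ((b =? a) && (j =? eval s i)) eqn:E.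
    + apply andb_true_iff in E as [E1 E2].
      apply Nat.eqb_eq in E1, E2; subst; now rewrite upd_eq.
    + rewrite upd_neq; [now apply Hr3|].
      intros E'; apply addr_inj in E' as [-> ->]; try lia.
      now rewrite !Nat.eqb_refl in E.
  - simpl in Hc, Hw; apply code_at_app in Hc as [Hc1 Hc2].
    apply andb_true_iff in Hw as [Hw1 Hw2].
    destruct (IH1 P p m Hc1 Hw1 Hr) as (u1 & m1 & Ht1 & E1 & Hr1).
    destruct (IH2 P _ m1 Hc2 Hw2 Hr1) as (u2 & m2 & Ht2 & E2 & Hr2).
    exists (u1 + u2), m2; repeat split; auto.
    + clear - Ht1 Ht2; cbn [slowdown]; nia.
    + rewrite exec_add, E1, E2; simpl; rewrite length_app; f_equal; lia.
  - simpl in Hc, Hw; rewrite !andb_true_iff in Hw; destruct Hw as [[We W1] W2].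
    pose proof Hc as Hc0.
    apply code_at_app in Hc as [_ Hc]; apply code_at_cons in Hc as [_ Hc].
    apply code_at_app in Hc as [Hc1 Hc]; apply code_at_cons in Hc as [Hj _].
    destruct (exec_test _ _ _ _ _ _ _ Hc0 We Hr) as (m0 & E0 & Hr0).
    rewrite (proj2 (Nat.eqb_neq _ _) He) in E0.
    destruct (IH P (p + length (cexpr 0 e) + 1) m0) as (u & m' & Ht & E & Hr'); auto.
    exists ((length (cexpr 0 e) + 1) + (u + 1)), m'; repeat split; auto.
    + clear - Ht; cbn [slowdown]; nia.
    + rewrite exec_add, E0, exec_add, E; simpl; rewrite Hj.
      rewrite !length_app; simpl; rewrite length_app; simpl; f_equal; lia.
  - simpl in Hc, Hw; rewrite !andb_true_iff in Hw; destruct Hw as [[We W1] W2].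
    pose proof Hc as Hc0.
    apply code_at_app in Hc as [_ Hc]; apply code_at_cons in Hc as [_ Hc].
    apply code_at_app in Hc as [Hc1 Hc]; apply code_at_cons in Hc as [_ Hc].
    destruct (exec_test _ _ _ _ _ _ _ Hc0 We Hr) as (m0 & E0 & Hr0).
    rewrite (proj2 (Nat.eqb_eq _ _) He) in E0.
    set (q := p + length (cexpr 0 e) + 1 + length (comp (p + length (cexpr 0 e) + 1) c1) + 1) in *.
    destruct (IH P q m0) as (u & m' & Ht & E & Hr'); auto.
    exists ((length (cexpr 0 e) + 1) + u), m'; repeat split; auto.
    + clear - Ht; cbn [slowdown]; nia.
    + rewrite exec_add, E0, E; simpl.
      rewrite !length_app; simpl; rewrite length_app; simpl; fold q; f_equal; unfold q; lia.
  - simpl in Hc, Hw; rewrite !andb_true_iff in Hw; destruct Hw as [We W1].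
    destruct (exec_test _ _ _ _ _ _ _ Hc We Hr) as (m0 & E0 & Hr0).
    rewrite (proj2 (Nat.eqb_eq _ _) He) in E0.
    exists (length (cexpr 0 e) + 1), m0; repeat split; auto.
    + cbn [slowdown]; lia.
    + rewrite E0; simpl; rewrite !length_app; simpl; rewrite length_app; simpl; f_equal; lia.
  - pose proof Hc as HcW; pose proof Hw as HwW.
    simpl in Hc, Hw; rewrite !andb_true_iff in Hw; destruct Hw as [We W1].
    pose proof Hc as Hc0.
    apply code_at_app in Hc as [_ Hc]; apply code_at_cons in Hc as [_ Hc].
    apply code_at_app in Hc as [Hc1 Hc]; apply code_at_cons in Hc as [Hj _].
    destruct (exec_test _ _ _ _ _ _ _ Hc0 We Hr) as (m0 & E0 & Hr0).
    rewrite (proj2 (Nat.eqb_neq _ _) He) in E0.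
    destruct (IH1 P (p + length (cexpr 0 e) + 1) m0) as (u & m1 & Ht & E & Hr1); auto.
    destruct (IH2 P p m1 HcW HwW Hr1) as (u2 & m2 & Ht2 & E2 & Hr2).
    exists ((length (cexpr 0 e) + 1) + (u + (1 + u2))), m2; repeat split; auto.
    + clear - Ht Ht2; cbn [slowdown] in *; nia.
    + rewrite exec_add, E0, exec_add, E, exec_add.
      replace (exec P 1 _) with (p, m1) by (simpl; now rewrite Hj).
      exact E2.
Qed.

(** * Program logic *)

Fixpoint writes (a : nat) (c : cmd) : bool :=
  match c with
  | Skip => false
  | Put b _ _ => a =? b
  | Seq c1 c2 | If _ c1 c2 => writes a c1 || writes a c2
  | While _ c => writes a c
  end.

(** Since [writes] computes, the preservation of a concrete array by a concrete command is proved by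
    [reflexivity]. *)
Definition frame (c : cmd) (s s' : env) : Prop :=
  forall a, writes a c = false -> forall i, s' a i = s a i.

Lemma ev_frame c s t s' : ev c s t s' -> frame c s s'.
Proof.
  induction 1 as [s|b i v s|c1 c2 s t1 s1 t2 s2 _ IH1 _ IH2
    |e c1 c2 s t s' _ _ IH|e c1 c2 s t s' _ _ IH|e c s _
    |e c s t1 s1 t2 s2 _ _ IH1 _ IH2]; intros a Ha j; simpl in Ha;
    try apply orb_false_iff in Ha as [Ha1 Ha2]; auto.
  - unfold put; now rewrite Ha.
  - rewrite IH2 by auto; auto.
  - rewrite IH2 by auto; auto.
Qed.

Definition run (c : cmd) (s : env) (T : nat) (Q : env -> Prop) : Prop :=
  exists t s', ev c s t s' /\ t <= T /\ Q s'.

Lemma run_conseq c s T T' (Q Q' : env -> Prop) :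
  run c s T Q -> T <= T' -> (forall s', Q s' -> frame c s s' -> Q' s') -> run c s T' Q'.
Proof.
  intros (t & s' & He & Ht & HQ) HT HQ'; exists t, s'; repeat split; auto; try lia.
  apply HQ'; auto; now apply ev_frame with t.
Qed.

Lemma run_skip s T (Q : env -> Prop) : Q s -> run Skip s T Q.
Proof. intros HQ; exists 0, s; repeat split; auto; [constructor|lia]. Qed.

Lemma run_put a i v s T (Q : env -> Prop) :
  1 <= T -> Q (put s a (eval s i) (eval s v)) -> run (Put a i v) s T Q.
Proof. intros HT HQ; eexists _, _; repeat split; [constructor|auto|auto]. Qed.

Lemma run_seq c1 c2 s T1 T2 T Q1 Q :
  run c1 s T1 Q1 -> T1 + T2 <= T ->
  (forall s1, Q1 s1 -> frame c1 s s1 -> run c2 s1 T2 Q) ->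
  run (Seq c1 c2) s T Q.
Proof.
  intros (t1 & s1 & He1 & Ht1 & HQ1) HT H2.
  destruct (H2 s1) as (t2 & s2 & He2 & Ht2 & HQ2); auto; [now apply ev_frame with t1|].
  exists (t1 + t2), s2; repeat split; auto; [econstructor; eauto|lia].
Qed.

Lemma run_put_seq a i v c s T Q :
  1 <= T -> run c (put s a (eval s i) (eval s v)) (T - 1) Q -> run (Seq (Put a i v) c) s T Q.
Proof.
  intros HT (t & s' & He & Ht & HQ); exists (1 + t), s'; repeat split; auto; [|lia].
  econstructor; eauto; constructor.
Qed.

Lemma run_if e c1 c2 s T Q :
  1 <= T -> (eval s e <> 0 -> run c1 s (T - 1) Q) -> (eval s e = 0 -> run c2 s (T - 1) Q) ->
  run (If e c1 c2) s T Q.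
Proof.
  intros HT H1 H2; destruct (Nat.eq_dec (eval s e) 0) as [E|E].
  - destruct (H2 E) as (t & s' & He & Ht & HQ).
    exists (S t), s'; repeat split; auto; [now apply ev_if_false|lia].
  - destruct (H1 E) as (t & s' & He & Ht & HQ).
    exists (S t), s'; repeat split; auto; [now apply ev_if_true|lia].
Qed.

(** [mu] bounds the number of iterations, each of which costs [B] and one test; the final 1 is the
    failing test. The body is given the frame from the initial state, so [I] has to speak only of
    what the loop writes. *)
Lemma run_while (I : env -> Prop) (mu : env -> nat) e c s T B :
  I s -> mu s * (B + 1) + 1 <= T ->
  (forall s1, I s1 -> frame c s s1 -> eval s1 e <> 0 ->
     run c s1 B (fun s2 => I s2 /\ mu s2 < mu s1)) ->
  run (While e c) s T (fun s' => I s' /\ eval s' e = 0).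
Proof.
  intros Hs HT Hbody.
  enough (H : forall k s1, mu s1 <= k -> I s1 -> frame c s s1 ->
      run (While e c) s1 (k * (B + 1) + 1) (fun s' => I s' /\ eval s' e = 0)).
  { apply run_conseq with (T := mu s * (B + 1) + 1)
      (Q := fun s' => I s' /\ eval s' e = 0); auto.
    apply H; auto; intros a _ i; auto. }
  induction k as [|k IH]; intros s1 Hk HI Hf;
    (destruct (Nat.eq_dec (eval s1 e) 0) as [E|E];
      [exists 1, s1; repeat split; auto; try lia; now constructor|]);
    destruct (Hbody s1 HI Hf E) as (t & s2 & He & Ht & HI2 & Hmu).
  - lia.
  - destruct (IH s2) as (t2 & s3 & He2 & Ht2 & HI3); try lia; auto.
    { intros a Ha i; rewrite (ev_frame _ _ _ _ He a Ha); now apply Hf. }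
    exists (S (t + t2)), s3; repeat split; try apply HI3; [|simpl; lia].
    now apply ev_while_true with s2.
Qed.

(** * The program *)

Coercion EC : nat >-> expr.
Declare Scope expr_scope.
Delimit Scope expr_scope with expr.
Bind Scope expr_scope with expr.
Arguments EG a%_nat e%_expr.
Arguments EA e1%_expr e2%_expr.
Arguments ES e1%_expr e2%_expr.
Arguments Put a%_nat i%_expr v%_expr.
Arguments Seq c1%_cmd c2%_cmd.
Arguments If e%_expr c1%_cmd c2%_cmd.
Arguments While e%_expr c%_cmd.
Infix "+" := EA : expr_scope.
Infix "-" := ES : expr_scope.
Notation "a @ e" := (EG a e) (at level 9, e at level 9, right associativity) : expr_scope.
Notation "% r" := (EG r (EC 0)) (at level 8, r at level 0, format "% r") : expr_scope.
Notation "r ::= e" := (Put r (EC 0) e) (at level 85, no associativity) : cmd_scope.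
Open Scope cmd_scope.

(** [a_tail] and [a_head] hold the residual arcs, [a_otail] and [a_ohead] the original ones,
    [a_true] the set S, [a_neg] a table of negations. [r_l] is the literal added as a source, [r_w]
    the unread guess word, [r_half] the weight of its top bit, [r_empty] twice the number of empty
    clauses. *)
Notation a_tail := 2 (only parsing).
Notation a_head := 3 (only parsing).
Notation a_otail := 4 (only parsing).
Notation a_ohead := 5 (only parsing).
Notation a_mark := 6 (only parsing).
Notation a_true := 7 (only parsing).
Notation a_neg := 8 (only parsing).
Notation r_n := 10 (only parsing).
Notation r_empty := 11 (only parsing).
Notation r_i := 12 (only parsing).
Notation r_x := 13 (only parsing).
Notation r_y := 14 (only parsing).
Notation r_hit := 15 (only parsing).
Notation r_l := 16 (only parsing).
Notation r_u := 17 (only parsing).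
Notation r_v := 18 (only parsing).
Notation r_j := 19 (only parsing).
Notation r_w := 20 (only parsing).
Notation r_half := 21 (only parsing).
Notation r_words := 22 (only parsing).
Notation r_ans := 23 (only parsing).
Notation r_2k := 24 (only parsing).
Notation r_cnt := 25 (only parsing).

(* On the nodes, a[x] := min(c, b[x]). *)
Definition c_nodes (c a b : nat) : cmd :=
  r_i ::= 0 ;;
  While (%r_n - %r_i) (
    Put a (a_otail@(%r_i)) (c - (c - b@(a_otail@(%r_i)))) ;;
    Put a (a_ohead@(%r_i)) (c - (c - b@(a_ohead@(%r_i)))) ;;
    r_i ::= %r_i + 1).

(* mark[x] is 1 for a source and i + 2 when x was reached through arc i; [r_hit]
   is a reached node whose negation is a source, or 0. *)
Definition c_search : cmd :=
  r_hit ::= 0 ;;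
  c_nodes 1 a_mark a_true ;;
  Put a_mark (%r_l) 1 ;;
  r_i ::= 0 ;;
  While (%r_n - %r_i) (
    r_v ::= a_head@(%r_i) ;;
    If (a_mark@(a_tail@(%r_i)))
      (If (a_mark@(%r_v))
        (r_i ::= %r_i + 1)
        (Put a_mark (%r_v) (%r_i + 2) ;;
         (* The sum vanishes exactly when the mark of the negation is 1, that is, when the negation
            is a source. *)
         If ((a_mark@(a_neg@(%r_v)) - 1) + (1 - a_mark@(a_neg@(%r_v))))
           Skip (r_hit ::= %r_v) ;;
         (* A new mark restarts the scan of all arcs, which replaces a queue at the price of
            quadratic time. *)
         r_i ::= 0))
      (r_i ::= %r_i + 1)).

Definition c_try : cmd :=
  c_search ;;
  If (%r_hit) Skip (c_nodes 1 a_true a_mark).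

(** Marks are not changed during the reversal, so they still lead back; the loop stops at a source,
    the mark of which is 1. *)
Definition c_augment : cmd :=
  r_v ::= %r_hit ;;
  While (a_mark@(%r_v) - 1) (
    r_i ::= a_mark@(%r_v) - 2 ;;
    r_u ::= a_tail@(%r_i) ;;
    Put a_tail (%r_i) (%r_v) ;;
    Put a_head (%r_i) (%r_u) ;;
    r_v ::= %r_u).

(** The marks in store come from the search for [r_y], so the search is repeated from the guessed
    literal to obtain the path to reverse. *)
Definition c_guess : cmd :=
  If (%r_w + 1 - %r_half)
    (r_l ::= %r_x ;; r_w ::= %r_w - %r_half)
    (r_l ::= %r_y) ;;
  r_w ::= %r_w + %r_w ;;
  c_search ;;
  c_augment ;;
  Put a_true (%r_l) 1.

(** Scanning the heads of the arcs is enough, as every node or its negation is a head. *)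
Definition c_decide : cmd :=
  r_x ::= a_ohead@(%r_j) ;;
  r_y ::= a_neg@(%r_x) ;;
  If (a_true@(%r_x) + a_true@(%r_y)) Skip (
    r_l ::= %r_x ;;
    c_try ;;
    If (%r_hit) (
      r_l ::= %r_y ;;
      c_try ;;
      If (%r_hit) c_guess Skip) Skip) ;;
  r_j ::= %r_j + 1.

Definition c_reset : cmd :=
  r_j ::= 0 ;;
  While (%r_n - %r_j) (
    Put a_tail (%r_j) (a_otail@(%r_j)) ;;
    Put a_head (%r_j) (a_ohead@(%r_j)) ;;
    r_j ::= %r_j + 1) ;;
  (* Capping at 0 empties the set. *)
  c_nodes 0 a_true a_mark ;;
  r_j ::= 0.

(** The count uses the original arcs, not the residual ones. The answer is never lowered, so a
    single accepting word decides. *)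
Definition c_verify : cmd :=
  r_cnt ::= 0 ;;
  r_i ::= 0 ;;
  While (%r_n - %r_i) (
    If (a_true@(a_otail@(%r_i)))
      (If (a_true@(a_ohead@(%r_i))) Skip (r_cnt ::= %r_cnt + 1))
      Skip ;;
    r_i ::= %r_i + 1) ;;
  If (%r_cnt + %r_empty - %r_2k) Skip (r_ans ::= 1).

Definition c_attempt : cmd :=
  c_reset ;;
  While (%r_n - %r_j) c_decide ;;
  c_verify.

Notation r_in := 33 (only parsing).
Notation r_out := 34 (only parsing).
Notation r_pow := 30 (only parsing).
Notation r_pow' := 31 (only parsing).
Notation r_rem := 32 (only parsing).
Notation r_a := 26 (only parsing).
Notation r_b := 27 (only parsing).
Notation r_na := 28 (only parsing).
Notation r_nb := 29 (only parsing).

(* The parity of x is that of its lowest bit, obtained by shifting x to the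
   left modulo a power of 2 larger than x. *)
Definition c_neg : cmd :=
  r_pow ::= 2 ;;
  While (%r_in + 1 - %r_pow) (r_pow ::= %r_pow + %r_pow) ;;
  r_pow' ::= 2 ;;
  r_rem ::= %r_in ;;
  While (%r_pow - %r_pow') (
    r_rem ::= %r_rem + %r_rem ;;
    If (%r_rem + 1 - %r_pow) (r_rem ::= %r_rem - %r_pow) Skip ;;
    r_pow' ::= %r_pow' + %r_pow') ;;
  If (%r_rem) (r_out ::= %r_in + 1) (r_out ::= %r_in - 1).

(** Negations are tabulated here, while the arcs are built, so that the search never has to compute
    a parity. *)
Definition c_clause : cmd :=
  r_a ::= 0@(%r_j + 1) ;;
  r_b ::= 1@(%r_j + 1) ;;
  If (%r_a) (
    If (%r_b) Skip (r_b ::= %r_a) ;;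
    r_in ::= %r_a ;; c_neg ;; r_na ::= %r_out ;;
    r_in ::= %r_b ;; c_neg ;; r_nb ::= %r_out ;;
    Put a_neg (%r_a) (%r_na) ;; Put a_neg (%r_na) (%r_a) ;;
    Put a_neg (%r_b) (%r_nb) ;; Put a_neg (%r_nb) (%r_b) ;;
    Put a_otail (%r_n) (%r_na) ;; Put a_ohead (%r_n) (%r_b) ;;
    Put a_otail (%r_n + 1) (%r_nb) ;; Put a_ohead (%r_n + 1) (%r_a) ;;
    r_n ::= %r_n + 2)
   (r_empty ::= %r_empty + 2) ;;
  r_j ::= %r_j + 1.

Definition c_build : cmd :=
  r_n ::= 0 ;;
  r_empty ::= 0 ;;
  r_j ::= 0 ;;
  While (1@0 - %r_j) c_clause.

Definition c_main : cmd :=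
  c_build ;;
  r_2k ::= 0@0 + 0@0 ;;
  r_half ::= 1 ;;
  r_j ::= %r_2k ;;
  While (%r_j) (r_half ::= %r_half + %r_half ;; r_j ::= %r_j - 1) ;;
  r_ans ::= 0 ;;
  r_words ::= %r_half + %r_half ;;
  While (%r_words) (
    r_words ::= %r_words - 1 ;;
    r_w ::= %r_words ;;
    c_attempt).

(** * Cuts in skew-symmetric networks *)

(** Exchanges the two codes 2v + 1 and 2v + 2 of a variable; the padding value 0 is a fixed
    point. *)
Definition neg (x : nat) : nat := if Nat.even x then pred x else S x.

Arguments neg : simpl never.

Lemma neg_neg x : neg (neg x) = x.
Proof.
  unfold neg; destruct (Nat.even x) eqn:E.
  - destruct x as [|x]; [reflexivity|]; simpl pred.
    rewrite Nat.even_succ in E; rewrite <- Nat.negb_odd, E; reflexivity.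
  - now rewrite Nat.even_succ, <- Nat.negb_even, E.
Qed.

Lemma neg_neq x : x <> 0 -> neg x <> x.
Proof. unfold neg; destruct (Nat.even x); lia. Qed.

(** Arcs are numbered, so parallel arcs count separately and the reversal of an arc is an update at
    one index. *)
Fixpoint out (T H : nat -> nat) (n : nat) (A : nat -> bool) : nat :=
  match n with
  | 0 => 0
  | S j => out T H j A + Nat.b2n (A (T j) && negb (A (H j)))
  end.

Lemma out_ext T H n A T' H' A' :
  (forall j, j < n -> A (T j) = A' (T' j) /\ A (H j) = A' (H' j)) ->
  out T H n A = out T' H' n A'.
Proof.
  induction n as [|n IH]; intros E; simpl; auto.
  rewrite IH by (intros; apply E; lia).
  now destruct (E n (Nat.lt_succ_diag_r n)) as [-> ->].
Qed.

Lemma out_eq_0 T H n A :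
  out T H n A = 0 <-> (forall j, j < n -> A (T j) = true -> A (H j) = true).
Proof.
  induction n as [|n IH]; simpl; [split; auto; lia|].
  rewrite Nat.eq_add_0, IH; split.
  - intros [H1 H2] j Hj Ht.
    destruct (Nat.eq_dec j n) as [->|]; [|apply H1; auto; lia].
    rewrite Ht in H2; now destruct (A (H n)).
  - intros H1; split; [intros; apply H1; auto|].
    specialize (H1 n (Nat.lt_succ_diag_r n)).
    destruct (A (T n)); simpl; auto; now rewrite H1.
Qed.

Lemma out_submodular T H n A B :
  out T H n (fun x => A x || B x) + out T H n (fun x => A x && B x)
  <= out T H n A + out T H n B.
Proof.
  induction n as [|n IH]; simpl; auto.
  enough (Nat.b2n ((A (T n) || B (T n)) && negb (A (H n) || B (H n)))
    + Nat.b2n ((A (T n) && B (T n)) && negb (A (H n) && B (H n)))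
    <= Nat.b2n (A (T n) && negb (A (H n))) + Nat.b2n (B (T n) && negb (B (H n)))) by lia.
  destruct (A (T n)), (A (H n)), (B (T n)), (B (H n)); simpl; lia.
Qed.

(** Reversing an arc changes a cut by the membership of its head minus that of its tail; along a
    path these changes telescope to the two ends. *)
Lemma out_reverse T H T' H' n i A :
  i < n -> T' i = H i -> H' i = T i ->
  (forall j, j <> i -> T' j = T j /\ H' j = H j) ->
  out T' H' n A + Nat.b2n (A (T i)) = out T H n A + Nat.b2n (A (H i)).
Proof.
  intros Hi ET EH E; induction n as [|n IH]; [lia|simpl].
  destruct (Nat.eq_dec i n) as [->|Hne].
  - rewrite ET, EH, (out_ext T' H' n A T H A).
    + destruct (A (T n)), (A (H n)); simpl; lia.
    + intros j Hj; destruct (E j) as [-> ->]; auto; lia.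
  - destruct (E n) as [-> ->]; auto.
    specialize (IH ltac:(lia)); lia.
Qed.

(** Counting arcs with an unmarked head spares an enumeration of the nodes. The count drops at each
    visit, because new marks are placed on heads of arcs. *)
Fixpoint unvisited (H M : nat -> nat) (k : nat) : nat :=
  match k with
  | 0 => 0
  | S j => unvisited H M j + (if M (H j) =? 0 then 1 else 0)
  end.

Lemma unvisited_le H M k : unvisited H M k <= k.
Proof. induction k as [|k IH]; simpl; auto; destruct (_ =? _); lia. Qed.

Lemma unvisited_mono H M M' k :
  (forall x, M x <> 0 -> M' x <> 0) -> unvisited H M' k <= unvisited H M k.
Proof.
  intros E; induction k as [|k IH]; simpl; auto.
  destruct (Nat.eqb_spec (M (H k)) 0), (Nat.eqb_spec (M' (H k)) 0); try lia.
  exfalso; now apply (E (H k)).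
Qed.

Lemma unvisited_decr H M M' k i :
  (forall x, M x <> 0 -> M' x <> 0) -> i < k -> M (H i) = 0 -> M' (H i) <> 0 ->
  unvisited H M' k < unvisited H M k.
Proof.
  intros E Hi Hz Hz'; induction k as [|k IH]; [lia|simpl].
  pose proof (unvisited_mono H M M' k E).
  destruct (Nat.eq_dec i k) as [->|].
  - rewrite Hz; destruct (Nat.eqb_spec (M' (H k)) 0); simpl; lia.
  - specialize (IH ltac:(lia)).
    destruct (Nat.eqb_spec (M (H k)) 0), (Nat.eqb_spec (M' (H k)) 0); try lia.
    exfalso; now apply (E (H k)).
Qed.

Ltac ss := cbn -[Nat.add Nat.sub Nat.mul Nat.pow Nat.log2 unvisited out].
Tactic Notation "ss" "in" hyp(H) :=
  cbn -[Nat.add Nat.sub Nat.mul Nat.pow Nat.log2 unvisited out] in H.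

(** * Smallest minimum cuts and persistency *)

Section Network.

Variables (OT OH : nat -> nat) (n : nat).

Definition node (x : nat) : Prop := exists j, j < n /\ (x = OT j \/ x = OH j).

Notation cut := (out OT OH n).

Hypothesis node_pos : forall x, node x -> x <> 0.
Hypothesis node_neg : forall x, node x -> node (neg x).
Hypothesis node_lit : forall x, node x -> exists j, j < n /\ (x = OH j \/ x = neg (OH j)).
Hypothesis cut_neg : forall A, cut (fun x => negb (A (neg x))) = cut A.

(** Sets are boolean functions on all numbers, compared on nodes only, since cuts see nothing
    else. *)
Definition contains (S A : nat -> bool) : Prop :=
  forall x, node x -> S x = true -> A x = true.

Definition good (S A : nat -> bool) : Prop :=
  forall x, node x -> S x = true -> A x = true /\ A (neg x) = false.

Definition consistent (S : nat -> bool) : Prop := good S S.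

Definition complete (Y : nat -> bool) : Prop :=
  forall x, node x -> Y (neg x) = negb (Y x).

Definition lower_bound (S : nat -> bool) (r : nat) : Prop :=
  forall A, good S A -> r <= cut A.

Definition attained (S : nat -> bool) (r : nat) : Prop :=
  exists A, good S A /\ cut A <= r.

Definition min_cut (S : nat -> bool) (r : nat) (R : nat -> bool) : Prop :=
  good S R /\ cut R <= r /\ (forall A, good S A -> cut A <= r -> contains R A).

Definition add_lit (S : nat -> bool) (l : nat) : nat -> bool := fun x => S x || (x =? l).

Lemma node_tail j : j < n -> node (OT j).
Proof. exists j; auto. Qed.

Lemma node_head j : j < n -> node (OH j).
Proof. exists j; auto. Qed.

Lemma cut_ext A B : (forall x, node x -> A x = B x) -> cut A = cut B.
Proof. intros E; apply out_ext; split; apply E; [now apply node_tail|now apply node_head]. Qed.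

Lemma good_contains S S' A : contains S S' -> good S' A -> good S A.
Proof. intros HS HA x Hx Sx; apply HA; auto. Qed.

Lemma good_union S A B : good S A -> good S B -> good S (fun x => A x || B x).
Proof.
  intros HA HB x Hx Sx; destruct (HA x Hx Sx) as [-> ->], (HB x Hx Sx) as [-> ->]; auto.
Qed.

Lemma good_inter S A B : good S A -> good S B -> good S (fun x => A x && B x).
Proof.
  intros HA HB x Hx Sx; destruct (HA x Hx Sx) as [-> ->], (HB x Hx Sx) as [-> ->]; auto.
Qed.

Lemma good_neg S A : good S A -> good S (fun x => negb (A (neg x))).
Proof.
  intros HA x Hx Sx; rewrite neg_neg; destruct (HA x Hx Sx) as [-> ->]; auto.
Qed.

Lemma good_complete S Y : complete Y -> contains S Y -> good S Y.
Proof. intros HY HS x Hx Sx; rewrite HY, (HS x) by auto; auto. Qed.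

Lemma contains_add S l : contains S (add_lit S l).
Proof. intros x _ Sx; unfold add_lit; now rewrite Sx. Qed.

Lemma lower_bound_contains S S' r :
  contains S S' -> lower_bound S r -> lower_bound S' r.
Proof. intros HS HL A HA; apply HL; now apply good_contains with S'. Qed.

Lemma lower_bound_succ S r :
  ~ attained S r -> lower_bound S (Datatypes.S r).
Proof.
  intros HF A HA; destruct (le_lt_dec (cut A) r); auto.
  exfalso; apply HF; exists A; auto.
Qed.

(** A node counts once for each arc end it occupies; the number serves only as a measure that is
    monotone in the set. *)
Definition node_count (A : nat -> bool) : nat :=
  length (filter (fun x => A x) (map OT (seq 0 n) ++ map OH (seq 0 n))).

Lemma in_nodes x : In x (map OT (seq 0 n) ++ map OH (seq 0 n)) <-> node x.
Proof.
  rewrite in_app_iff, !in_map_iff; unfold node; split.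
  - intros [(j & <- & Hj)|(j & <- & Hj)]; apply in_seq in Hj; exists j; split; auto; lia.
  - intros (j & Hj & [-> | ->]); [left|right]; exists j; rewrite in_seq; split; auto; lia.
Qed.

Lemma node_count_inter A B :
  node_count A <= node_count (fun x => A x && B x) -> contains A B.
Proof.
  unfold node_count; intros Hle x Hx Ax.
  apply in_nodes in Hx.
  assert (Hmono : forall l, length (filter (fun x => A x && B x) l)
                            <= length (filter (fun x => A x) l)).
  { induction l as [|y l IH]; simpl; auto.
    destruct (A y), (B y); simpl; lia. }
  induction (map OT (seq 0 n) ++ map OH (seq 0 n)) as [|y l IH]; [easy|simpl in *].
  specialize (Hmono l).
  destruct Hx as [->|Hx].
  - rewrite Ax in Hle; destruct (B x); auto; simpl in Hle; lia.
  - apply IH; auto.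
    destruct (A y), (B y); simpl in Hle; lia.
Qed.

(** By submodularity the intersection of two good cuts of value at most r is again one, as their
    union has value at least r. Intersections are taken as long as the node count drops. *)
Lemma min_cut_exists S r :
  lower_bound S r -> attained S r -> exists R, min_cut S r R.
Proof.
  intros HL (A & HA & Hc).
  revert Hc; induction A as [A IH] using (induction_ltof1 _ node_count).
  intros Hc.
  destruct (classic (exists B, good S B /\ cut B <= r /\
      node_count (fun x => A x && B x) < node_count A)) as [(B & HB & HcB & Hlt)|Hno].
  - apply (IH _ Hlt).
    + now apply good_inter.
    + pose proof (out_submodular OT OH n A B).
      pose proof (HL _ (good_union _ _ _ HA HB)); lia.
  - exists A; repeat split; auto; try apply HA; auto.
    intros B HB HcB; apply node_count_inter.
    destruct (le_lt_dec (node_count A) (node_count (fun x => A x && B x))); auto.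
    exfalso; apply Hno; eauto.
Qed.

(** The complement of the negation of R is another good cut of the same value, so by minimality it
    contains R. *)
Lemma min_cut_consistent S r R : min_cut S r R -> consistent R.
Proof.
  intros (HR & Hc & Hmin) x Hx Rx; split; auto.
  apply negb_true_iff, (Hmin (fun x => negb (R (neg x)))); auto.
  - now apply good_neg.
  - now rewrite cut_neg.
Qed.

Lemma min_cut_unique S r R R' x :
  min_cut S r R -> min_cut S r R' -> node x -> R x = R' x.
Proof.
  intros (H1 & H2 & H3) (H1' & H2' & H3') Hx.
  apply eq_true_iff_eq; split; [apply H3|apply H3']; auto.
Qed.

(* Uncrossing Y first with R and then with the complement of neg R, another
   cut of value at most r, overwrites Y by R without increasing the cut. *)
Lemma persistency S S' r R Y :
  contains S S' -> lower_bound S r -> min_cut S' r R ->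
  complete Y -> contains S Y ->
  exists Y', complete Y' /\ contains R Y' /\ cut Y' <= cut Y.
Proof.
  intros HS HL HR HY HSY.
  pose proof (min_cut_consistent _ _ _ HR) as Hcons.
  destruct HR as (HgR & HcR & _).
  apply (good_contains _ _ _ HS) in HgR.
  pose proof (good_complete _ _ HY HSY) as HgY.
  set (R' := fun x => negb (R (neg x))).
  assert (HcR' : cut R' <= r) by (unfold R'; now rewrite cut_neg).
  assert (HgR' : good S R') by now apply good_neg.
  exists (fun x => (Y x || R x) && R' x); repeat split.
  - intros x Hx; unfold R'; rewrite HY, neg_neg by auto.
    destruct (R x) eqn:E1, (R (neg x)) eqn:E2; auto;
      try (destruct (Hcons x Hx E1); congruence); now destruct (Y x).
  - intros x Hx Rx; unfold R'; destruct (Hcons x Hx Rx) as [_ ->].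
    now rewrite Rx, orb_true_r.
  - pose proof (out_submodular OT OH n Y R).
    pose proof (HL _ (good_inter _ _ _ HgY HgR)).
    pose proof (out_submodular OT OH n (fun x => Y x || R x) R').
    pose proof (HL _ (good_union _ _ _ (good_union _ _ _ HgY HgR) HgR')).
    simpl in *; lia.
Qed.

(** * Guess words and the branch of a solution *)

Definition covers (S : nat -> bool) (j : nat) : Prop :=
  forall i, i < j -> S (OH i) = true \/ S (neg (OH i)) = true.

Lemma covers_complete S : covers S n -> consistent S -> complete S.
Proof.
  intros Hcov Hcons x Hx.
  assert (H : S x = true \/ S (neg x) = true).
  { destruct (node_lit x Hx) as (j & Hj & [-> | ->]); [auto|rewrite neg_neg].
    destruct (Hcov j Hj); auto. }
  destruct H as [H|H].
  - rewrite H; now destruct (Hcons x Hx H).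
  - rewrite H; destruct (Hcons (neg x) (node_neg x Hx) H) as [_ E].
    rewrite neg_neg in E; now rewrite E.
Qed.

(* [budget] bounds the final cut; the guess word [w] is read from the bit of
   weight [H] downwards, by doubling modulo [2 * H]. *)
Fixpoint wins (H budget fuel j : nat) (S : nat -> bool) (r w : nat) : Prop :=
  match fuel with
  | 0 => cut S <= budget
  | Datatypes.S fuel =>
      let x := OH j in
      let next := wins H budget fuel (j + 1) in
      ((S x = true \/ S (neg x) = true) /\ next S r w) \/
      (S x = false /\ S (neg x) = false /\
        ((exists R, min_cut (add_lit S x) r R /\ next R r w) \/
         (~ attained (add_lit S x) r /\
          exists R, min_cut (add_lit S (neg x)) r R /\ next R r w) \/
         (~ attained (add_lit S x) r /\ ~ attained (add_lit S (neg x)) r /\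
          ((H <= w /\ next (add_lit S x) (r + 1) (2 * (w - H))) \/
           (w < H /\ next (add_lit S (neg x)) (r + 1) (2 * w))))))
  end.

Lemma covers_succ S S' j :
  covers S j -> contains S S' -> j < n ->
  S' (OH j) = true \/ S' (neg (OH j)) = true -> covers S' (j + 1).
Proof.
  intros HC HS Hj H i Hi.
  destruct (Nat.eq_dec i j) as [->|]; auto.
  destruct (HC i) as [E|E]; [lia| |]; [left|right]; apply HS; auto;
    [|apply node_neg]; apply node_head; lia.
Qed.

(** The run is guided by a solution Y: a free step overwrites Y by persistency, a guess follows Y.
    The word is assembled from its end; after r guesses it has been doubled r times, hence the form
    [2 ^ r * q]. *)
Lemma wins_exists D budget fuel : budget <= D -> forall j S r Y,
  j + fuel = n -> lower_bound S r -> consistent S -> covers S j ->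
  complete Y -> contains S Y -> cut Y <= budget ->
  exists q, 2 ^ r * q < 2 * 2 ^ D /\ wins (2 ^ D) budget fuel j S r (2 ^ r * q).
Proof.
  intros HD; induction fuel as [|fuel IH]; intros j S r Y Hj HL Hcons HC HY HSY Hb; cbn [wins].
  (* Here S is complete and contained in the complete set Y, so the two agree on all nodes. *)
  - exists 0; rewrite Nat.mul_0_r; split; [pose proof (Nat.pow_nonzero 2 D); lia|].
    rewrite (cut_ext S Y); auto.
    intros x Hx; rewrite Nat.add_0_r in Hj; subst j.
    pose proof (covers_complete S HC Hcons x Hx) as HcS.
    destruct (S x) eqn:E; [symmetry; now apply HSY|].
    simpl in HcS; apply HSY in HcS; [|now apply node_neg].
    rewrite HY in HcS by auto; now destruct (Y x).
  - set (x := OH j).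
    assert (Hjn : j < n) by lia.
    assert (Hx : node x) by now apply node_head.
    assert (Hx' : node (neg x)) by now apply node_neg.
    destruct (S x) eqn:Sx; [|destruct (S (neg x)) eqn:Sx'].
    + destruct (IH (j + 1) S r Y) as (q & Hq & Hw); auto; try lia.
      { apply covers_succ with S; auto; intros ?; auto. }
      exists q; split; auto.
    + destruct (IH (j + 1) S r Y) as (q & Hq & Hw); auto; try lia.
      { apply covers_succ with S; auto; intros ?; auto. }
      exists q; split; auto.
    + assert (Hfree : forall l, l = x \/ l = neg x -> attained (add_lit S l) r ->
        exists q R, 2 ^ r * q < 2 * 2 ^ D /\ min_cut (add_lit S l) r R /\
          wins (2 ^ D) budget fuel (j + 1) R r (2 ^ r * q)).
      { intros l Hl Hatt.
        pose proof (contains_add S l) as HSl.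
        destruct (min_cut_exists (add_lit S l) r) as (R & HR); auto.
        { now apply lower_bound_contains with S. }
        destruct (persistency S _ r R Y HSl) as (Y' & HY' & HRY' & Hc'); auto.
        assert (HSR : contains S R) by (intros y Hy Sy; apply (proj1 HR); auto).
        destruct (IH (j + 1) R r Y') as (q & Hq & Hw); auto; try lia.
        - now apply lower_bound_contains with S.
        - now apply min_cut_consistent with (add_lit S l) r.
        - apply covers_succ with S; auto.
          destruct Hl as [-> | ->]; [left|right]; apply (proj1 HR); auto; unfold add_lit;
            rewrite Nat.eqb_refl; apply orb_true_r.
        - exists q, R; auto. }
      destruct (classic (attained (add_lit S x) r)) as [H1|H1].
      { destruct (Hfree x) as (q & R & Hq & HR & Hw); auto.
        exists q; split; auto; right; eauto 8. }
      destruct (classic (attained (add_lit S (neg x)) r)) as [H2|H2].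
      { destruct (Hfree (neg x)) as (q & R & Hq & HR & Hw); auto.
        exists q; split; auto; right; eauto 8. }
      (* Y itself is a good cut, so the lower bound cannot pass the budget while a solution
         survives; therefore [2 ^ r] divides [2 ^ D] and a bit is left to read. *)
      assert (Hr : r <= budget)
        by (pose proof (HL Y (good_complete _ _ HY HSY)); lia).
      assert (Hguess : forall l, l = x \/ l = neg x -> Y l = true ->
        ~ attained (add_lit S l) r ->
        exists q, 2 ^ (r + 1) * q < 2 * 2 ^ D /\
          wins (2 ^ D) budget fuel (j + 1) (add_lit S l) (r + 1) (2 ^ (r + 1) * q)).
      { intros l Hl Yl Hatt.
        assert (HSl : contains (add_lit S l) Y).
        { intros y Hy; unfold add_lit; rewrite orb_true_iff, Nat.eqb_eq.
          intros [Sy| ->]; auto. }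
        apply IH with Y; auto; try lia.
        - rewrite Nat.add_1_r; now apply lower_bound_succ.
        - intros y Hy Sy; split; auto.
          destruct (add_lit S l (neg y)) eqn:E; auto.
          apply HSl in E; [|now apply node_neg]; rewrite HY, (HSl y) in E; easy.
        - apply covers_succ with S; auto; [apply contains_add|].
          destruct Hl as [-> | ->]; [left|right]; unfold add_lit;
            rewrite Nat.eqb_refl; apply orb_true_r. }
      assert (EH : 2 ^ D = 2 ^ r * 2 ^ (D - r))
        by (rewrite <- Nat.pow_add_r; f_equal; lia).
      destruct (Y x) eqn:Yx.
      * destruct (Hguess x) as (q & Hq & Hw); auto.
        rewrite Nat.pow_add_r, Nat.pow_1_r in Hq, Hw.
        (* This sets the top bit: the word is [2 ^ D + 2 ^ r * q], and reading the bit leaves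
           [2 ^ (r + 1) * q]. In the other case the bit is clear and doubling alone has this
           effect. *)
        exists (2 ^ (D - r) + q).
        rewrite Nat.mul_add_distr_l, <- EH; split; [lia|].
        right; repeat split; auto; right; right; repeat split; auto; left; split; [lia|].
                now replace (2 * (2 ^ D + 2 ^ r * q - 2 ^ D)) with (2 ^ r * 2 * q) by lia.
      * destruct (Hguess (neg x)) as (q & Hq & Hw); auto.
        { now rewrite HY, Yx. }
        rewrite Nat.pow_add_r, Nat.pow_1_r in Hq, Hw.
        exists q; split; [lia|].
        right; repeat split; auto; right; right; repeat split; auto; right; split; [lia|].
        now replace (2 * (2 ^ r * q)) with (2 ^ r * 2 * q) by lia.
Qed.

(** * Residual graphs and closed sets *)

Definition flow (T H : nat -> nat) (S : nat -> bool) (r : nat) : Prop :=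
  forall A, good S A -> cut A = out T H n A + r.

Definition closed (T H : nat -> nat) (A : nat -> bool) : Prop :=
  forall j, j < n -> A (T j) = true -> A (H j) = true.

Lemma flow_lower_bound T H S r : flow T H S r -> lower_bound S r.
Proof. intros HF A HA; rewrite (HF A HA); lia. Qed.

Lemma flow_contains T H S S' r : contains S S' -> flow T H S r -> flow T H S' r.
Proof. intros HS HF A HA; apply HF; now apply good_contains with S'. Qed.

Lemma reach_min_cut T H S l r R :
  flow T H S r -> closed T H R -> good (add_lit S l) R ->
  (forall A, closed T H A -> contains (add_lit S l) A -> contains R A) ->
  min_cut (add_lit S l) r R.
Proof.
  intros HF HR Hg Hmin; repeat split; try (apply Hg; auto).
  - rewrite HF by (eapply good_contains; [apply contains_add|exact Hg]).
    now rewrite (proj2 (out_eq_0 T H n R) HR).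
  - intros A HA Hc; apply Hmin.
    + refine (proj1 (out_eq_0 T H n A) _).
      rewrite HF in Hc by (eapply good_contains; [apply contains_add|exact HA]); lia.
    + intros x Hx Sx; now apply HA.
Qed.

(** A cut attaining r would be a closed set containing the sources, hence would contain a node whose
    negation is a source; a good cut avoids such a node. *)
Lemma reach_not_attained T H S l r :
  flow T H S r ->
  (forall A, closed T H A -> contains (add_lit S l) A ->
     exists x, node x /\ A x = true /\ add_lit S l (neg x) = true) ->
  ~ attained (add_lit S l) r.
Proof.
  intros HF Hhit (A & HA & Hc).
  destruct (Hhit A) as (x & Hx & Ax & Sx).
  - refine (proj1 (out_eq_0 T H n A) _).
    rewrite HF in Hc by (eapply good_contains; [apply contains_add|exact HA]); lia.
  - intros x Hx Sx; now apply HA.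
  - destruct (HA (neg x) (node_neg x Hx) Sx) as [_ E].
    rewrite neg_neg in E; congruence.
Qed.

(** * Correctness of one attempt *)

(** The network data that an attempt only reads. *)
Definition base (s : env) : Prop :=
  s r_n 0 = n /\
  (forall j, j < n -> s a_otail j = OT j /\ s a_ohead j = OH j) /\
  (forall x, node x -> s a_neg x = neg x).

Lemma base_ext s s' :
  (forall a, In a [r_n; a_otail; a_ohead; a_neg] -> forall i, s' a i = s a i) ->
  base s -> base s'.
Proof.
  intros E (H1 & H2 & H3); repeat split.
  - now rewrite E by (simpl; auto).
  - rewrite E by (simpl; auto); now apply H2.
  - rewrite E by (simpl; auto); now apply H2.
  - intros x Hx; rewrite E by (simpl; auto); auto.
Qed.

Ltac split_eqb :=
  repeat match goal with
    | |- context [?x =? ?x] => rewrite (Nat.eqb_refl x)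
    | |- context [?x =? ?y] => destruct (Nat.eqb_spec x y)
    end.

(** Listing the two pairs of arrays that occur, instead of assuming disjointness, reduces all side
    conditions to computation. *)
Lemma c_nodes_spec c a b s :
  In (a, b) [(a_mark, a_true); (a_true, a_mark)] -> base s ->
  run (c_nodes c a b) s (4 * n + 2)
    (fun s' => forall x, node x -> s' a x = c - (c - s b x)).
Proof.
  intros Hab Hs.
  apply run_put_seq; [lia|].
  eapply run_conseq.
  - apply run_while with
      (I := fun s1 => s1 r_i 0 <= n /\ forall j, j < s1 r_i 0 ->
              s1 a (OT j) = c - (c - s b (OT j)) /\ s1 a (OH j) = c - (c - s b (OH j)))
      (mu := fun s1 => n - s1 r_i 0) (B := 3).
    + cbn; split; [lia|intros; lia].
    + cbn -[Nat.mul]; reflexivity.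
    + intros s1 [Hi Hj] Hf He.
      destruct Hs as (Hn & Hst & _).
      assert (Hin : s1 r_i 0 < n).
      { cbn in He; rewrite Hf in He by (destruct Hab as [[= <- <-]|[[= <- <-]|[]]]; reflexivity).
        cbn in He; lia. }
      assert (E4 : s1 a_otail (s1 r_i 0) = OT (s1 r_i 0))
        by (rewrite Hf by (destruct Hab as [[= <- <-]|[[= <- <-]|[]]]; reflexivity); now apply Hst).
      assert (E5 : s1 a_ohead (s1 r_i 0) = OH (s1 r_i 0))
        by (rewrite Hf by (destruct Hab as [[= <- <-]|[[= <- <-]|[]]]; reflexivity); now apply Hst).
      assert (Eb : forall x, s1 b x = s b x)
        by (intros x; rewrite Hf by (destruct Hab as [[= <- <-]|[[= <- <-]|[]]]; reflexivity);
            destruct Hab as [[= <- <-]|[[= <- <-]|[]]]; reflexivity).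
      apply run_put_seq; [lia|]; apply run_put_seq; [lia|]; apply run_put; [lia|].
      destruct Hab as [[= <- <-]|[[= <- <-]|[]]]; cbn -[Nat.sub Nat.add];
        rewrite E4, E5, !Eb; (split; [split; [lia|]|lia]); intros j Hlt;
        (destruct (Nat.eq_dec j (s1 r_i 0)) as [->|Hne];
         [rewrite Nat.eqb_refl|destruct (Hj j) as [-> ->]; [lia|]]);
        split;
        split_eqb; auto; congruence.
  - lia.
  - intros s' [[Hi Hj] He] Hf x (j & Hlt & Hx).
    destruct Hs as (Hn & _).
    cbn in He; rewrite Hf in He by (destruct Hab as [[= <- <-]|[[= <- <-]|[]]]; reflexivity).
    cbn in He; destruct (Hj j) as [E1 E2]; [lia|].
    now destruct Hx as [-> | ->].
Qed.

(* The rank, the number of arcs with a visited head at the time of the visit,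
   decreases along parent pointers and shows that they form no cycle. *)
Definition parents (T H M rank : nat -> nat) : Prop :=
  forall x, node x -> 2 <= M x ->
    exists j, j < n /\ M x = j + 2 /\ H j = x /\ M (T j) <> 0 /\ rank (T j) < rank x.

(** The last clause says that marked nodes are reachable, without mentioning paths. The bound on
    ranks guarantees that a rank above all present ones is available at the next visit. *)
Definition marked (T H : nat -> nat) (src : nat -> bool) (M : nat -> nat) : Prop :=
  (forall x, node x -> M x = 1 <-> src x = true) /\
  (exists rank, (forall x, rank x <= n - unvisited H M n) /\ parents T H M rank) /\
  (forall A, closed T H A -> contains src A -> forall x, node x -> M x <> 0 -> A x = true).

Definition hit_ok (M : nat -> nat) (hit : nat) : Prop :=
  (hit = 0 /\ forall x, node x -> M x <> 0 -> M (neg x) <> 1) \/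
  (node hit /\ M hit <> 0 /\ M (neg hit) = 1).

Definition nodes_graph (T H : nat -> nat) : Prop :=
  forall j, j < n -> node (T j) /\ node (H j).

Lemma marked_init T H src M :
  (forall x, node x -> M x = Nat.b2n (src x)) -> marked T H src M.
Proof.
  intros E; repeat split.
  - rewrite E by auto; now destruct (src x).
  - rewrite E by auto; now intros ->.
  - exists (fun _ => 0); split; [intros; lia|].
    intros x Hx; rewrite E by auto; destruct (src x); simpl; lia.
  - intros A _ HA x Hx; rewrite E by auto; destruct (src x) eqn:Ex; [auto|easy].
Qed.

Lemma marked_step T H src M i M' :
  nodes_graph T H -> marked T H src M -> i < n -> M (T i) <> 0 -> M (H i) = 0 ->
  M' (H i) = i + 2 -> (forall x, x <> H i -> M' x = M x) ->
  marked T H src M' /\ unvisited H M' n < unvisited H M n.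
Proof.
  intros HG (H1 & (rank & Hrk & H2) & H3) Hi HT HH EM' E.
  assert (Hle : forall x, M x <> 0 -> M' x <> 0).
  { intros x Hx; destruct (Nat.eq_dec x (H i)) as [->|]; [congruence|].
    rewrite E by auto; auto. }
  assert (Hlt : unvisited H M' n < unvisited H M n)
    by (apply unvisited_decr with i; auto; lia).
  pose proof (unvisited_le H M n).
  split; auto; repeat split.
  - destruct (Nat.eq_dec x (H i)) as [->|]; [lia|rewrite E by auto; now apply H1].
  - intros Hs; destruct (Nat.eq_dec x (H i)) as [->|].
    + apply H1 in Hs; auto; lia.
    + rewrite E by auto; now apply H1.
  (* The new rank exceeds all earlier ones, because the number of unvisited arcs has just
     dropped. *)
  - exists (fun x => if x =? H i then n - unvisited H M' n else rank x); split.
    + intros x; destruct (x =? H i); auto; specialize (Hrk x); lia.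
    + intros x Hx Mx; destruct (Nat.eqb_spec x (H i)) as [->|Hne].
      * exists i; repeat split; auto.
        destruct (Nat.eqb_spec (T i) (H i)); [congruence|specialize (Hrk (T i)); lia].
      * rewrite E in Mx by auto; destruct (H2 x Hx Mx) as (j & Hj & EM & EH & HTj & Hr).
        exists j; repeat split; auto.
        -- rewrite E; auto.
        -- destruct (Nat.eqb_spec (T j) (H i)); [congruence|auto].
  - intros A HA HS x Hx Mx; destruct (Nat.eq_dec x (H i)) as [->|].
    + apply HA; auto; apply (H3 A); auto; now apply HG.
    + rewrite E in Mx by auto; now apply (H3 A).
Qed.

Lemma hit_ok_step M M' hit v i :
  node v -> hit_ok M hit -> M v = 0 -> M' v = i + 2 ->
  (forall x, x <> v -> M' x = M x) -> M' (neg v) <> 1 -> hit_ok M' hit.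
Proof.
  intros Hv HO Mv EM' E Hn.
  destruct HO as [[-> HO]|(Hh & Mh & Mn)]; [left|right].
  - split; auto; intros x Hx Mx.
    destruct (Nat.eq_dec x v) as [->|Hne]; auto.
    destruct (Nat.eq_dec (neg x) v) as [->|]; [lia|].
    rewrite E in * by auto; auto.
  - assert (hit <> v) by congruence; assert (neg hit <> v) by congruence.
    rewrite !E by auto; auto.
Qed.

(** Bounds the iterations of a search: at most n restarts, with a scan of at most n arcs before,
    between and after them. *)
Definition sqr_succ_n : nat := (n + 1) * (n + 1).

Lemma c_search_spec s S l :
  base s -> nodes_graph (s a_tail) (s a_head) ->
  (forall x, node x -> s a_true x = Nat.b2n (S x)) -> s r_l 0 = l -> node l ->
  consistent (add_lit S l) ->
  run c_search s (20 * sqr_succ_n) (fun s' =>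
    marked (s a_tail) (s a_head) (add_lit S l) (s' a_mark) /\
    (forall j, j < n -> s' a_mark (s a_tail j) <> 0 -> s' a_mark (s a_head j) <> 0) /\
    hit_ok (s' a_mark) (s' r_hit 0)).
Proof.
  intros Hb HG HS El Hl Hcons.
  assert (Hsz : n + 1 <= sqr_succ_n) by (unfold sqr_succ_n; nia).
  apply run_put_seq; [lia|].
  eapply run_seq with (T2 := 12 * sqr_succ_n).
  { apply c_nodes_spec; [simpl; auto|].
    apply (base_ext s); auto; simpl; intros a [<-|[<-|[<-|[<-|[]]]]] i; reflexivity. }
  { lia. }
  intros s1 Hm Hf1; cbv beta in Hm.
  apply run_put_seq; [lia|]; apply run_put_seq; [lia|].
  assert (Fr : forall a, In a [2; 3; 4; 5; 7; 8; 10; 16] -> forall i, s1 a i = s a i).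
  { intros a Ha i; simpl in Ha.
    repeat (destruct Ha as [<-|Ha]; [rewrite Hf1 by reflexivity; reflexivity|]); easy. }
  assert (Es1l : s1 16 0 = l) by (rewrite Fr; simpl; tauto).
  eapply run_conseq.
  - apply run_while with
      (I := fun s2 => s2 r_i 0 <= n /\
         marked (s a_tail) (s a_head) (add_lit S l) (s2 a_mark) /\
         (forall j, j < s2 r_i 0 -> s2 a_mark (s a_tail j) <> 0 -> s2 a_mark (s a_head j) <> 0) /\
         hit_ok (s2 a_mark) (s2 r_hit 0))
      (* A lexicographic measure: a visit lowers the first component, which outweighs the return of
         the scan to arc 0. *)
      (mu := fun s2 => unvisited (s a_head) (s2 a_mark) n * (n + 1) + (n - s2 r_i 0)) (B := 7).
    + ss; rewrite Es1l.
      assert (E1 : forall x, node x ->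
        (if x =? l then 1 else s1 6 x) = Nat.b2n (add_lit S l x)).
      { intros x Hx; unfold add_lit; destruct (x =? l); [now rewrite orb_true_r|].
        rewrite orb_false_r, Hm by auto; ss; rewrite HS by auto.
        now destruct (S x). }
      split; [lia|split; [now apply marked_init|split; [intros; lia|]]].
      (* Only sources are marked at this point, and by consistency no source has a source as its
         negation. *)
      left; split; [rewrite Hf1 by reflexivity; reflexivity|].
      intros x Hx; ss; rewrite !E1 by auto.
      destruct (add_lit S l x) eqn:Ex; [|easy].
      destruct (Hcons x Hx Ex) as [_ ->]; easy.
    + apply Nat.le_refl.
    + intros s2 (Hi & HM & Hcl & HO) Hf He.
      assert (Fr2 : forall a, In a [2; 3; 4; 5; 7; 8; 10; 16] -> forall i, s2 a i = s a i).
      { intros a Ha i; rewrite <- Fr by auto; simpl in Ha.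
        repeat (destruct Ha as [<-|Ha]; [rewrite Hf by reflexivity; reflexivity|]); easy. }
      destruct Hb as (Hn & Hst & Hneg).
      assert (Hin : s2 r_i 0 < n).
      { ss in He; rewrite Fr2 in He by (simpl; tauto); lia. }
      set (i := s2 r_i 0) in *.
      assert (Ev : node (s a_head i)) by now apply HG.
      apply run_put_seq; [lia|].
      ss; fold i.
      rewrite (Fr2 a_head) by (simpl; tauto).
      set (v := s a_head i) in *.
      set (s3 := put s2 18 0 v).
      assert (Edone : forall T, 1 <= T -> (s2 a_mark (s a_tail i) <> 0 -> s2 a_mark v <> 0) ->
        run (r_i ::= %r_i + 1) s3 T (fun s4 =>
          (s4 r_i 0 <= n /\ marked (s a_tail) (s a_head) (add_lit S l) (s4 a_mark) /\
          (forall j, j < s4 r_i 0 -> s4 a_mark (s a_tail j) <> 0 -> s4 a_mark (s a_head j) <> 0) /\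
          hit_ok (s4 a_mark) (s4 r_hit 0)) /\
          unvisited (s a_head) (s4 a_mark) n * (n + 1) + (n - s4 r_i 0) <
          unvisited (s a_head) (s2 a_mark) n * (n + 1) + (n - i))).
      { intros T HT Hv; apply run_put; [lia|]; ss; fold i.
        split; [split; [lia|split; [exact HM|split; [|exact HO]]]|].
        - intros j Hj; destruct (Nat.eq_dec j i) as [->|]; [auto|apply Hcl; lia].
        - change (put s3 12 0 (i + 1) 6) with (s2 6); lia. }
      apply run_if; [lia| |]; ss; fold i; rewrite (Fr2 a_tail) by (simpl; tauto); intros HT.
      * apply run_if; [lia| |]; ss; intros HH; [apply Edone; auto; lia|].
        apply run_put_seq; [lia|]; ss; fold i.
        set (s4 := put s3 6 v (i + 2)).
        assert (HM4 : marked (s a_tail) (s a_head) (add_lit S l) (s4 a_mark) /\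
          unvisited (s a_head) (s4 a_mark) n < unvisited (s a_head) (s2 a_mark) n).
        { apply marked_step with i; auto; unfold s4, s3; ss; fold v; [now rewrite Nat.eqb_refl|].
          intros x Hx; now destruct (Nat.eqb_spec x v). }
        destruct HM4 as [HM4 Hlt4].
        apply run_seq with (T1 := 2) (T2 := 1)
          (Q1 := fun s5 => s5 a_mark = s4 a_mark /\ hit_ok (s4 a_mark) (s5 r_hit 0)); [|lia|].
        -- assert (Ec : s2 a_neg v = neg v) by (rewrite Fr2; [auto|simpl; tauto]).
           apply run_if; [lia| |]; intros Hc; unfold s4, s3 in Hc; ss in Hc; rewrite Ec in Hc.
           ++ apply run_skip; split; [reflexivity|].
              apply (hit_ok_step (s2 a_mark) _ _ v i); auto; unfold s4, s3; ss.
              ** now rewrite Nat.eqb_refl.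
              ** intros x Hx; now destruct (Nat.eqb_spec x v).
              ** lia.
           ++ apply run_put; [lia|]; split; [reflexivity|]; right.
              unfold s4, s3; ss; repeat split; auto.
              ** rewrite Nat.eqb_refl; lia.
              ** lia.
        -- intros s5 [E5 HO5] Hf5.
           apply run_put; [lia|]; ss.
           change (put s5 12 0 0 6) with (s5 6); rewrite E5.
           split; [split; [lia|split; [exact HM4|split; [intros; lia|exact HO5]]]|nia].
      * apply Edone; [lia|easy].
  - ss; match goal with |- context [unvisited ?a ?b ?c] => pose proof (unvisited_le a b c) end.
    unfold sqr_succ_n in *; nia.
  - intros s' [(Hi & HM & Hcl & HO) He] Hf; split; [auto|split; [|auto]].
    intros j Hj; apply Hcl.
    ss in He; rewrite Hf in He by reflexivity; ss in He.
    destruct Hb as (Hn & _); rewrite Fr in He by (simpl; tauto); lia.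
Qed.

(** By [out_reverse] the changes telescope between the hit and the source z where the walk ends. A
    reversal spoils only the parent arc of the node being left; since ranks decrease along the walk,
    the invariant asks for intact parent arcs only up to the current rank. *)
Lemma c_augment_spec s rank :
  nodes_graph (s a_tail) (s a_head) -> parents (s a_tail) (s a_head) (s a_mark) rank ->
  (forall x, rank x <= n) -> node (s r_hit 0) -> s a_mark (s r_hit 0) <> 0 ->
  run c_augment s (6 * n + 2) (fun s' =>
    nodes_graph (s' a_tail) (s' a_head) /\
    exists z, node z /\ s a_mark z = 1 /\
      forall A, out (s' a_tail) (s' a_head) n A + Nat.b2n (A z) =
                out (s a_tail) (s a_head) n A + Nat.b2n (A (s r_hit 0))).
Proof.
  intros HG HP Hrk Hh Mh.
  apply run_put_seq; [lia|].
  eapply run_conseq.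
  - apply run_while with
      (I := fun s1 => let v := s1 r_v 0 in
         node v /\ s a_mark v <> 0 /\ nodes_graph (s1 a_tail) (s1 a_head) /\
         (forall A, out (s1 a_tail) (s1 a_head) n A + Nat.b2n (A v) =
                    out (s a_tail) (s a_head) n A + Nat.b2n (A (s r_hit 0))) /\
         (forall x, node x -> rank x <= rank v -> 2 <= s a_mark x ->
            exists j, j < n /\ s a_mark x = j + 2 /\ s1 a_head j = x /\
              s a_mark (s1 a_tail j) <> 0 /\ rank (s1 a_tail j) < rank x))
      (mu := fun s1 => rank (s1 r_v 0)) (B := 5).
    + cbv zeta; ss; repeat (split; [auto|]).
      intros x Hx _ Mx; now apply HP.
    + apply Nat.le_refl.
    + intros s1 (Hv & Mv & HG1 & Hout & HP1) Hf He.
      set (v := s1 r_v 0) in *.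
      assert (EM : forall x, s1 6 x = s 6 x) by (intros x; now rewrite Hf).
      ss in He; fold v in He; rewrite EM in He.
      destruct (HP1 v) as (i & Hi & Ei & Eh & Mt & Hr); auto; [lia|].
      repeat (apply run_put_seq; [lia|]); apply run_put; [lia|].
      ss; fold v; rewrite EM, Ei, Nat.add_sub.
      set (u := s1 2 i) in *.
      destruct (HG1 i Hi) as [Hu _]; fold u in Hu.
      assert (E2 : forall T' H', T' = (fun j => if j =? i then v else s1 2 j) ->
        H' = (fun j => if j =? i then u else s1 3 j) ->
        nodes_graph T' H' /\ forall A, out T' H' n A + Nat.b2n (A u) =
          out (s1 2) (s1 3) n A + Nat.b2n (A v)).
      { intros T' H' -> ->; split.
        - intros j Hj; destruct (HG1 j Hj); destruct (j =? i); auto.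
        - intros A; rewrite <- Eh; apply out_reverse; auto; try now rewrite Nat.eqb_refl.
          intros j Hj; apply Nat.eqb_neq in Hj; now rewrite Hj. }
      destruct (E2 _ _ eq_refl eq_refl) as [HG2 Hout2].
      split; [|auto]; split; [auto|split; [auto|split; [exact HG2|split]]].
      * intros A; specialize (Hout A); specialize (Hout2 A).
        etransitivity; [exact Hout2|exact Hout].
      * intros x Hx Hrx Mx.
        destruct (HP1 x) as (j & Hj & Ej & Ehj & Mtj & Hrj); auto; [lia|].
        assert (Hne : j <> i) by (intros ->; rewrite Eh in Ehj; subst x; lia).
        apply Nat.eqb_neq in Hne; exists j; rewrite Hne; auto.
  - ss; specialize (Hrk (s r_hit 0)); nia.
  - intros s' [(Hv & Mv & HG1 & Hout & _) He] Hf; split; auto.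
    exists (s' r_v 0); repeat split; auto.
    ss in He; rewrite Hf in He by reflexivity; ss in He; lia.
Qed.

(** * The invariant of the growing set, maintained by free steps and guesses *)

Definition sinv (s : env) (S : nat -> bool) (r : nat) : Prop :=
  base s /\ nodes_graph (s a_tail) (s a_head) /\
  (forall x, node x -> s a_true x = Nat.b2n (S x)) /\
  consistent S /\ flow (s a_tail) (s a_head) S r.

Lemma sinv_ext s s' S r :
  (forall a, In a
     [a_tail; a_head; a_otail; a_ohead; a_true; a_neg; r_n] -> forall i, s' a i = s a i) ->
  sinv s S r -> sinv s' S r.
Proof.
  intros E (Hb & HG & HS & HC & HF); repeat split.
  - rewrite E by (simpl; auto 10); apply Hb.
  - rewrite E by (simpl; auto 10); now apply Hb.
  - rewrite E by (simpl; auto 10); now apply Hb.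
  - intros x Hx; rewrite E by (simpl; auto 10); now apply Hb.
  - rewrite E by (simpl; auto 10); now apply HG.
  - rewrite E by (simpl; auto 10); now apply HG.
  - intros x Hx; rewrite E by (simpl; auto 10); auto.
  - now apply HC.
  - now apply HC.
  - intros A HA; rewrite (HF A HA); f_equal; apply out_ext; intros j Hj.
    now rewrite !E by (simpl; auto 10).
Qed.

Lemma sinv_frame c s s' S r :
  frame c s s' -> forallb (fun a => negb (writes a c))
    [a_tail; a_head; a_otail; a_ohead; a_true; a_neg; r_n] = true ->
  sinv s S r -> sinv s' S r.
Proof.
  intros Hf Hw; apply sinv_ext; intros a Ha i; apply Hf.
  rewrite forallb_forall in Hw; now apply negb_true_iff, Hw.
Qed.

Lemma sinv_lower_bound s S r : sinv s S r -> lower_bound S r.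
Proof. intros (_ & _ & _ & _ & HF); now apply flow_lower_bound in HF. Qed.

Lemma add_lit_consistent S l :
  consistent S -> node l -> S (neg l) = false -> consistent (add_lit S l).
Proof.
  intros HC Hl Sl x Hx Sx; split; auto; unfold add_lit in *.
  apply orb_false_iff; apply orb_true_iff in Sx as [Sx|Sx].
  - split; [now apply HC|].
    apply Nat.eqb_neq; intros E.
    rewrite <- E, neg_neg in Sl; congruence.
  - apply Nat.eqb_eq in Sx as ->; split; auto.
    apply Nat.eqb_neq, neg_neq, node_pos; auto.
Qed.

(** All that the reversal of the path just found relies on. *)
Definition blocked (s : env) (S : nat -> bool) (l : nat) : Prop :=
  node (s r_hit 0) /\ s a_mark (s r_hit 0) <> 0 /\
  add_lit S l (neg (s r_hit 0)) = true /\
  (forall x, node x -> s a_mark x = 1 -> add_lit S l x = true) /\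
  exists rank, (forall x, rank x <= n) /\ parents (s a_tail) (s a_head) (s a_mark) rank.

Lemma c_search_cases s S r l :
  sinv s S r -> s r_l 0 = l -> node l -> S (neg l) = false ->
  run c_search s (20 * sqr_succ_n) (fun s' =>
    sinv s' S r /\ s' r_l 0 = l /\
    ((s' r_hit 0 = 0 /\
      min_cut (add_lit S l) r (fun x => negb (s' a_mark x =? 0))) \/
     (s' r_hit 0 <> 0 /\ ~ attained (add_lit S l) r /\ blocked s' S l))).
Proof.
  intros Hs El Hl Sl.
  pose proof Hs as (Hb & HG & HS & HC & HF).
  pose proof (add_lit_consistent S l HC Hl Sl) as HC'.
  eapply run_conseq; [now apply (c_search_spec s S l)|auto|].
  intros s' ((H1 & (rank & Hrk & HP) & Hmin) & Hcl & HO) Hf.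
  split; [now apply (sinv_frame _ _ _ _ _ Hf)|].
  split; [now rewrite Hf|].
  assert (Hnz : forall x, negb (s' a_mark x =? 0) = true <-> s' a_mark x <> 0)
    by (intros x; now rewrite negb_true_iff, Nat.eqb_neq).
  destruct HO as [[E0 HO]|(Hh & Mh & Mn)]; [left|right]; (split; [now auto|]).
  - apply (reach_min_cut (s a_tail) (s a_head)); auto.
    + intros j Hj; rewrite !Hnz; auto.
    + intros x Hx Sx; apply H1 in Sx; auto; split; [apply Hnz; lia|].
      apply negb_false_iff, Nat.eqb_eq.
      destruct (Nat.eq_dec (s' 6 (neg x)) 0) as [|Hne]; auto.
      exfalso; apply (HO (neg x)); auto; now rewrite neg_neg.
    + intros A HA HAS x Hx; rewrite Hnz; now apply Hmin.
  - split.
    + apply (reach_not_attained (s a_tail) (s a_head)); auto.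
      intros A HA HAS; exists (s' r_hit 0).
      split; [auto|split; [now apply (Hmin A)|apply H1; auto]].
    + split; [auto|split; [auto|split; [apply H1; auto|split]]].
      * intros x Hx; apply H1; auto.
      * exists rank; split; [intros x; specialize (Hrk x); lia|].
        intros x Hx Mx; destruct (HP x Hx Mx) as (j & Hj & E1 & E2 & E3 & E4).
        exists j; rewrite (Hf 3), (Hf 2) by reflexivity; auto.
Qed.

(** The success case is stated for every smallest cut R, because [wins] supplies its own; R is
    unique on nodes, so the array represents whichever is given. *)
Lemma c_try_spec s S r l :
  sinv s S r -> s r_l 0 = l -> node l -> S (neg l) = false ->
  run c_try s (30 * sqr_succ_n) (fun s' =>
    (s' r_hit 0 = 0 /\ attained (add_lit S l) r /\
      forall R, min_cut (add_lit S l) r R -> sinv s' R r) \/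
    (s' r_hit 0 <> 0 /\ ~ attained (add_lit S l) r /\ sinv s' S r)).
Proof.
  intros Hs El Hl Sl.
  assert (Hsz : n + 1 <= sqr_succ_n) by (unfold sqr_succ_n; nia).
  eapply run_seq with (T2 := 10 * sqr_succ_n); [apply c_search_cases; eauto|lia|].
  intros s1 (Hs1 & El1 & Hcases) Hf1.
  apply run_if; [lia| |]; ss; intros Hh; (destruct Hcases as [[Hh' HM]|(Hh' & HA & _)]; [|]);
    try contradiction.
  - apply run_skip; right; auto.
  - pose proof Hs1 as (Hb & HG & HS & HC & HF).
    eapply run_conseq; [apply c_nodes_spec; [simpl; auto|auto]|lia|].
    intros s2 Hm Hf2; left; split; [now rewrite Hf2|split].
    + eexists; split; [apply HM|apply HM].
    + intros R HR.
      assert (HSR : contains S R).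
      { intros x Hx Sx; apply (proj1 HR); auto; now apply contains_add. }
      assert (E : forall a, In a [2; 3; 4; 5; 8; 10] -> forall i, s2 a i = s1 a i).
      { intros a Ha i; simpl in Ha.
        repeat (destruct Ha as [<-|Ha]; [now rewrite Hf2|]); easy. }
      split; [apply (base_ext s1); auto; intros a Ha; apply E; simpl in *; tauto|].
      split; [intros j Hj; rewrite !E by (simpl; tauto); now apply HG|].
      split; [|split; [now apply min_cut_consistent in HR|]].
      * intros x Hx; rewrite Hm by auto.
        rewrite (min_cut_unique _ _ _ _ x HR HM) by auto.
        destruct (Nat.eqb_spec (s1 6 x) 0) as [->|Hne]; cbn [negb Nat.b2n]; lia.
      * apply (flow_contains _ _ _ _ _ HSR) in HF.
        intros A HA; rewrite (HF A HA); f_equal; apply out_ext; intros j Hj.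
        now rewrite !E by (simpl; tauto).
Qed.

Lemma c_guess_spec s S r x w :
  sinv s S r -> s r_x 0 = x -> s r_y 0 = neg x -> s r_w 0 = w ->
  node x -> S x = false -> S (neg x) = false ->
  ~ attained (add_lit S x) r -> ~ attained (add_lit S (neg x)) r ->
  run c_guess s (40 * sqr_succ_n) (fun s' =>
    (s r_half 0 <= w /\ sinv s' (add_lit S x) (r + 1) /\ s' r_w 0 = 2 * (w - s r_half 0)) \/
    (w < s r_half 0 /\ sinv s' (add_lit S (neg x)) (r + 1) /\ s' r_w 0 = 2 * w)).
Proof.
  intros Hs Ex Ey Ew Hx Sx Sy Ax Ay.
  assert (Hsz : n + 1 <= sqr_succ_n) by (unfold sqr_succ_n; nia).
  eapply run_seq with (T1 := 3) (T2 := 40 * sqr_succ_n - 3)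
    (Q1 := fun s1 => sinv s1 S r /\
       ((s r_half 0 <= w /\ s1 r_l 0 = x /\ s1 r_w 0 = w - s r_half 0) \/
        (w < s r_half 0 /\ s1 r_l 0 = neg x /\ s1 r_w 0 = w))); [|lia|].
  { apply run_if; [lia| |]; ss; intros Hw.
    - apply run_put_seq; [lia|]; apply run_put; [lia|]; ss; split; [exact Hs|].
      left; lia.
    - apply run_put; [lia|]; ss; split; [exact Hs|].
      right; lia. }
  intros s1 (Hs1 & Hc) Hf1.
  apply run_put_seq; [lia|]; ss.
  set (s2 := put _ _ _ _).
  assert (Hs2 : sinv s2 S r) by exact Hs1.
  set (l := s1 r_l 0) in *.
  assert (Hl : node l /\ S l = false /\ S (neg l) = false /\ ~ attained (add_lit S l) r).
  { destruct Hc as [(_ & -> & _)|(_ & -> & _)]; rewrite ?neg_neg; auto. }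
  destruct Hl as (Hl & Sl & Snl & Al).
  assert (Hend : run (c_search;; c_augment;; Put a_true (%r_l) 1) s2 (40 * sqr_succ_n - 3 - 1)
    (fun s' => sinv s' (add_lit S l) (r + 1) /\ s' r_w 0 = s1 r_w 0 + s1 r_w 0)).
  { eapply run_seq with (T2 := 10 * sqr_succ_n); [apply (c_search_cases s2 S r l); auto|lia|].
    intros s3 (Hs3 & El3 & Hcases) Hf3.
    destruct Hcases as [[_ HM]|(_ & _ & Hh & Mh & Sh & Hsrc & rank & Hrk & HP)].
    { exfalso; apply Al; eexists; split; apply HM. }
    pose proof Hs3 as (Hb & HG & HS & HC & HF).
    eapply run_seq with (T2 := 1); [now apply c_augment_spec with rank|lia|].
    intros s4 (HG4 & z & Hz & Mz & Hout) Hf4.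
    apply run_put; [lia|]; ss.
    assert (El4 : s4 16 0 = l) by now rewrite Hf4.
    rewrite El4, Hf4, Hf3 by reflexivity; split; [|reflexivity].
    split; [|split; [|split; [|split]]].
    - apply (base_ext s3); auto; intros a Ha i; simpl in Ha.
      repeat (destruct Ha as [<-|Ha]; [ss; now rewrite Hf4|]); easy.
    - exact HG4.
    - intros y Hy; ss; rewrite Hf4, HS by auto; unfold add_lit.
      destruct (y =? l); [now rewrite orb_true_r|now rewrite orb_false_r].
    - now apply add_lit_consistent.
    (* A good cut contains z, a source, and avoids the hit, whose negation is a source; so the two
       boolean terms of [Hout] are 1 and 0. *)
    - intros A HA; specialize (Hout A).
      apply Hsrc in Mz; auto.
      destruct (HA _ Hz Mz) as [Az _].
      destruct (HA _ (node_neg _ Hh) Sh) as [_ Ah]; rewrite neg_neg in Ah.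
      rewrite Az, Ah in Hout; cbn [Nat.b2n] in Hout.
      change (put s4 7 l 1 2) with (s4 2); change (put s4 7 l 1 3) with (s4 3).
      rewrite (HF A) by (apply good_contains with (add_lit S l); [apply contains_add|auto]).
      lia. }
  eapply run_conseq; [exact Hend|auto|].
  intros s' [Hs' Ew'] _.
  destruct Hc as [(Hw & E & E')|(Hw & E & E')]; rewrite E in Hs'; [left|right];
    (split; [auto|split; [auto|]]); rewrite Ew', E'; lia.
Qed.

(** All words are run, winning or not, so the set invariant holds unconditionally while [wins] is
    only transported. The outcomes of the two searches decide which alternative of [wins] can
    hold. *)
Lemma c_decide_spec budget fuel s S r j :
  sinv s S r -> s r_j 0 = j -> j < n -> covers S j ->
  run c_decide s (120 * sqr_succ_n) (fun s' => s' r_j 0 = j + 1 /\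
    exists S' r', sinv s' S' r' /\ covers S' (j + 1) /\
      (wins (s r_half 0) budget (Datatypes.S fuel) j S r (s r_w 0) ->
       wins (s r_half 0) budget fuel (j + 1) S' r' (s' r_w 0))).
Proof.
  remember (Datatypes.S fuel) as m eqn:Em; intros Hs Ej Hj Hcov.
  assert (Hsz : n + 1 <= sqr_succ_n) by (unfold sqr_succ_n; nia).
  pose proof (sinv_lower_bound _ _ _ Hs) as HL.
  pose proof Hs as ((Hn & Hst & Hneg) & _ & HS & HC & _).
  set (x := OH j).
  assert (Hx : node x) by now apply node_head.
  assert (Hx' : node (neg x)) by auto.
  assert (Ex : s a_ohead (s r_j 0) = x) by (rewrite Ej; now apply Hst).
  apply run_put_seq; [lia|]; apply run_put_seq; [lia|]; ss.
  rewrite Ex, (Hneg x Hx).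
  set (s1 := put _ _ _ _).
  assert (Hs1 : sinv s1 S r) by exact Hs.
  assert (Hfree : forall l s', l = x \/ l = neg x -> attained (add_lit S l) r ->
      (forall R, min_cut (add_lit S l) r R -> sinv s' R r) ->
      (wins (s r_half 0) budget (m) j S r (s r_w 0) ->
        exists R, min_cut (add_lit S l) r R /\
                  wins (s r_half 0) budget fuel (j + 1) R r (s' r_w 0)) ->
      exists S' r', sinv s' S' r' /\ covers S' (j + 1) /\
        (wins (s r_half 0) budget (m) j S r (s r_w 0) ->
         wins (s r_half 0) budget fuel (j + 1) S' r' (s' r_w 0))).
  { intros l s' Hl Hatt Hsinv Hw.
    assert (HR : exists R, min_cut (add_lit S l) r R /\
        (wins (s r_half 0) budget (m) j S r (s r_w 0) ->
         wins (s r_half 0) budget fuel (j + 1) R r (s' r_w 0))).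
    (* The new set has to be chosen before the implication is entered: it is the cut provided by
       [wins] if the word wins, and any smallest cut otherwise. *)
    { destruct (classic (wins (s r_half 0) budget (m) j S r (s r_w 0)))
        as [HW|HW].
      - destruct (Hw HW) as (R & HR & HwR); eauto.
      - destruct (min_cut_exists (add_lit S l) r) as (R & HR); auto.
        { apply lower_bound_contains with S; auto; apply contains_add. }
        exists R; split; auto; contradiction. }
    destruct HR as (R & HR & HwR); exists R, r; split; [auto|split; [|auto]].
    assert (HSR : contains (add_lit S l) R) by (intros y Hy Sy; now apply (proj1 HR)).
    apply covers_succ with S; auto.
    - intros y Hy Sy; apply HSR; auto; now apply contains_add.
    - fold x; destruct Hl as [-> | ->]; [left|right]; apply HSR; auto; unfold add_lit;
        rewrite Nat.eqb_refl; apply orb_true_r. }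
  apply run_seq with (T1 := 115 * sqr_succ_n) (T2 := 1)
    (Q1 := fun s' => exists S' r', sinv s' S' r' /\ covers S' (j + 1) /\
      (wins (s r_half 0) budget (m) j S r (s r_w 0) ->
       wins (s r_half 0) budget fuel (j + 1) S' r' (s' r_w 0))); [|lia|].
  - apply run_if; [lia| |]; unfold s1; ss; fold s1; rewrite !HS by auto; intros He.
    { apply run_skip; exists S, r.
      assert (Sx : S x = true \/ S (neg x) = true).
      { destruct (S x); auto; destruct (S (neg x)); auto. }
      split; [auto|split; [now apply covers_succ with S|]].
      rewrite Em; cbn [wins]; intros [[_ Hw]|(E1 & E2 & _)]; [exact Hw|exfalso].
      fold x in E1, E2; destruct Sx; congruence. }
    assert (Sx : S x = false /\ S (neg x) = false).
    { destruct (S x), (S (neg x)); simpl in He; auto; lia. }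
    destruct Sx as [Sx Sy].
    apply run_put_seq; [lia|].
    eapply run_seq with (T2 := 80 * sqr_succ_n); [apply (c_try_spec _ S r x)|lia|]; auto.
    intros s2 Hc2 Hf2.
    assert (Hc2w : s2 r_w 0 = s r_w 0) by now rewrite Hf2.
    apply run_if; [lia| |]; ss; intros Hh2;
      destruct Hc2 as [(Hh2' & A2 & HR2)|(Hh2' & A2 & Hs2)]; try contradiction.
    2:{ apply run_skip, (Hfree x); auto; rewrite Hc2w.
        rewrite Em; cbn [wins]; fold x.
        intros [[[E|E] _]|(_ & _ & [(R & HR & Hw)|[(A & _)|(A & _)]])];
          try congruence; try contradiction; eauto. }
    apply run_put_seq; [lia|]; ss.
    assert (Ey : s2 r_y 0 = neg x) by now rewrite Hf2.
    rewrite Ey.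
    eapply run_seq with (T2 := 45 * sqr_succ_n); [apply (c_try_spec _ S r (neg x))|lia|]; auto.
    { now rewrite neg_neg. }
    intros s3 Hc3 Hf3.
    assert (Hc3w : s3 r_w 0 = s r_w 0) by now rewrite Hf3.
    apply run_if; [lia| |]; ss; intros Hh3;
      destruct Hc3 as [(Hh3' & A3 & HR3)|(Hh3' & A3 & Hs3)]; try contradiction.
    2:{ apply run_skip, (Hfree (neg x)); auto; rewrite Hc3w.
        rewrite Em; cbn [wins]; fold x.
        intros [[[E|E] _]|(_ & _ &
          [(R & HR & Hw)|[(A & R & HR & Hw)|(A & A' & _)]])];
          try congruence; try contradiction; eauto.
        exfalso; apply A2; exists R; split; apply HR. }
    assert (Eh : s3 r_half 0 = s r_half 0)
      by (rewrite Hf3 by reflexivity; ss; rewrite Hf2 by reflexivity; reflexivity).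
    eapply run_conseq; [apply (c_guess_spec s3 S r x (s r_w 0)); auto| lia|].
    + rewrite Hf3 by reflexivity; ss; rewrite Hf2 by reflexivity; reflexivity.
    + rewrite Hf3 by reflexivity; ss; exact Ey.
    + intros s4 Hc4 _; rewrite Eh in Hc4.
      assert (HcovS : forall l, l = x \/ l = neg x -> covers (add_lit S l) (j + 1)).
      { intros l Hl; apply covers_succ with S; auto; [apply contains_add|].
        fold x; destruct Hl as [-> | ->]; [left|right]; unfold add_lit;
          rewrite Nat.eqb_refl; apply orb_true_r. }
      assert (Hw4 : wins (s r_half 0) budget (m) j S r (s r_w 0) ->
        (s r_half 0 <= s r_w 0 /\ wins (s r_half 0) budget fuel (j + 1)
           (add_lit S x) (r + 1) (2 * (s r_w 0 - s r_half 0))) \/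
        (s r_w 0 < s r_half 0 /\ wins (s r_half 0) budget fuel (j + 1)
           (add_lit S (neg x)) (r + 1) (2 * s r_w 0))).
      { rewrite Em; cbn [wins]; fold x.
        intros [[[E|E] _]|(_ & _ &
          [(R & HR & _)|[(_ & R & HR & _)|(_ & _ & Hw)]])];
          try congruence; auto; exfalso;
          [apply A2|apply A3]; exists R; split; apply HR. }
      destruct Hc4 as [(Hle & Hs4 & ->)|(Hlt & Hs4 & ->)];
        eexists _, _; (split; [exact Hs4|split; [apply HcovS; auto|]]);
        intros HW; destruct (Hw4 HW) as [[? ?]|[? ?]]; auto; lia.
  - intros s2 (S' & r' & Hs2 & Hcov2 & Hw2) Hf2.
    apply run_put; [lia|]; ss; split.
    + rewrite Hf2 by reflexivity; unfold s1; ss; lia.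
    + exists S', r'; split; [exact Hs2|auto].
Qed.

Lemma c_reset_spec s :
  base s -> run c_reset s (10 * sqr_succ_n) (fun s' => s' r_j 0 = 0 /\ sinv s' (fun _ => false) 0).
Proof.
  intros Hb.
  assert (Hsz : n + 1 <= sqr_succ_n) by (unfold sqr_succ_n; nia).
  pose proof Hb as (Hn & Hst & Hneg).
  apply run_put_seq; [lia|].
  eapply run_seq with (T2 := 5 * sqr_succ_n).
  - apply run_while with
      (I := fun s1 => s1 r_j 0 <= n /\
        forall i, i < s1 r_j 0 -> s1 a_tail i = OT i /\ s1 a_head i = OH i)
      (mu := fun s1 => n - s1 r_j 0) (B := 3).
    + ss; split; [lia|intros; lia].
    + apply Nat.le_refl.
    + intros s1 [Hi HI] Hf He.
      ss in He; rewrite Hf in He by reflexivity; ss in He.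
      destruct (Hst (s1 r_j 0)) as [E4 E5]; [lia|].
      do 2 (apply run_put_seq; [lia|]); apply run_put; [lia|]; ss.
      rewrite (Hf 4), (Hf 5) by reflexivity; ss; rewrite E4, E5.
      split; [split; [lia|]|lia].
      intros i Hlt; destruct (Nat.eqb_spec i (s1 19 0)) as [->|]; [auto|apply HI; lia].
  - ss; lia.
  - intros s1 [[Hi HI] He] Hf1.
    ss in He; rewrite Hf1 in He by reflexivity; ss in He.
    assert (Hb1 : base s1).
    { apply (base_ext s); auto; intros a Ha i; simpl in Ha.
      repeat (destruct Ha as [<-|Ha]; [now rewrite Hf1|]); easy. }
    eapply run_seq with (T2 := 1); [apply c_nodes_spec; [simpl; auto|exact Hb1]|lia|].
    intros s2 Hm Hf2; apply run_put; [lia|]; ss; split; [reflexivity|].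
    assert (E : forall i, i < n -> s2 2 i = OT i /\ s2 3 i = OH i).
    { intros i Hlt; rewrite !Hf2 by reflexivity; apply HI; lia. }
    split; [|split; [|split; [|split]]].
    + apply (base_ext s1); auto; intros a Ha i; simpl in Ha.
      repeat (destruct Ha as [<-|Ha]; [ss; now rewrite Hf2|]); easy.
    + intros i Hlt; ss; destruct (E i Hlt) as [-> ->].
      split; [now apply node_tail|now apply node_head].
    + intros x Hx; ss; rewrite Hm by auto; reflexivity.
    + intros x Hx; easy.
    + intros A _; rewrite Nat.add_0_r; apply out_ext; intros i Hlt; ss.
      now destruct (E i Hlt) as [-> ->].
Qed.

Lemma c_verify_spec s S :
  base s -> (forall x, node x -> s a_true x = Nat.b2n (S x)) ->
  run c_verify s (10 * sqr_succ_n) (fun s' =>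
    (cut S + s r_empty 0 <= s r_2k 0 /\ s' r_ans 0 = 1) \/
    (s r_2k 0 < cut S + s r_empty 0 /\ s' r_ans 0 = s r_ans 0)).
Proof.
  intros (Hn & Hst & Hneg) HS.
  assert (Hsz : n + 1 <= sqr_succ_n) by (unfold sqr_succ_n; nia).
  do 2 (apply run_put_seq; [lia|]).
  eapply run_seq with (T2 := 2).
  - apply run_while with
      (I := fun s1 => s1 r_i 0 <= n /\ s1 r_cnt 0 = out OT OH (s1 r_i 0) S)
      (mu := fun s1 => n - s1 r_i 0) (B := 4).
    + ss; split; [lia|reflexivity].
    + apply Nat.le_refl.
    + intros s1 [Hi HI] Hf He.
      ss in He; rewrite Hf in He by reflexivity; ss in He.
      set (i := s1 12 0) in *.
      assert (Hlt : i < n) by lia.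
      destruct (Hst i Hlt) as [E4 E5].
      apply run_seq with (T1 := 3) (T2 := 1)
        (Q1 := fun s2 => s2 r_cnt 0 = out OT OH (i + 1) S); [|lia|].
      * rewrite Nat.add_1_r; cbn [out]; rewrite <- HI.
        assert (E : forall a j, In a [4; 5; 7] -> s1 a j = s a j).
        { intros a j Ha; simpl in Ha.
          repeat (destruct Ha as [<-|Ha]; [now rewrite Hf|]); easy. }
        apply run_if; [lia| |]; ss; fold i;
          rewrite !E, E4, HS by (simpl; auto; now apply node_tail);
          intros H4; [apply run_if; [lia| |]; ss; fold i;
            rewrite !E, E5, HS by (simpl; auto; now apply node_head); intros H5|];
          [apply run_skip|apply run_put; [lia|]; ss|apply run_skip].
        -- destruct (S (OH i)); [|easy]; destruct (S (OT i)); simpl; lia.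
        -- destruct (S (OH i)); [easy|]; destruct (S (OT i)); [simpl; lia|easy].
        -- destruct (S (OT i)); [easy|]; simpl; lia.
      * intros s2 E2 Hf2; apply run_put; [lia|]; ss.
        rewrite (Hf2 12) by reflexivity; fold i; split; [split; [lia|auto]|lia].
  - ss; lia.
  - intros s1 [[Hi HI] He] Hf1.
    ss in He; rewrite Hf1 in He by reflexivity; ss in He.
    replace (s1 12 0) with n in HI by lia.
    apply run_if; [lia| |]; ss; rewrite HI, (Hf1 11), (Hf1 24) by reflexivity; ss; intros Hc.
    + apply run_skip; right; rewrite Hf1 by reflexivity; ss; split; [lia|reflexivity].
    + apply run_put; [lia|]; ss; left; split; [lia|reflexivity].
Qed.

(** Completeness of the final set makes acceptance sound for every word; the bound under [wins]
    makes a winning word accepted. *)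
Lemma c_attempt_spec budget s :
  base s ->
  run c_attempt s (200 * sqr_succ_n * (n + 1)) (fun s' =>
    exists S, complete S /\
      (wins (s r_half 0) budget n 0 (fun _ => false) 0 (s r_w 0) -> cut S <= budget) /\
      ((cut S + s r_empty 0 <= s r_2k 0 /\ s' r_ans 0 = 1) \/
       (s r_2k 0 < cut S + s r_empty 0 /\ s' r_ans 0 = s r_ans 0))).
Proof.
  intros Hb.
  assert (Hsz : n + 1 <= sqr_succ_n) by (unfold sqr_succ_n; nia).
  eapply run_seq with (T2 := 190 * sqr_succ_n * (n + 1)); [now apply c_reset_spec|nia|].
  intros s1 [Ej1 Hs1] Hf1.
  eapply run_seq with (T2 := 10 * sqr_succ_n).
  - apply run_while with
      (I := fun s2 => s2 r_j 0 <= n /\ exists S r, sinv s2 S r /\ covers S (s2 r_j 0) /\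
         (wins (s r_half 0) budget n 0 (fun _ => false) 0 (s r_w 0) ->
          wins (s r_half 0) budget (n - s2 r_j 0) (s2 r_j 0) S r (s2 r_w 0)))
      (mu := fun s2 => n - s2 r_j 0) (B := 120 * sqr_succ_n).
    + split; [lia|]; exists (fun _ => false), 0; rewrite Ej1.
      split; [auto|split; [intros i Hi; lia|]].
      rewrite Nat.sub_0_r, (Hf1 20) by reflexivity; auto.
    + apply Nat.le_refl.
    + intros s2 (Hj & S & r & Hs2 & Hcov & Hw) Hf2 He.
      assert (En : s2 r_n 0 = n) by apply Hs2.
      ss in He; rewrite En in He.
      eapply run_conseq;
        [apply (c_decide_spec budget (n - s2 r_j 0 - 1) s2 S r (s2 r_j 0)); auto; lia|auto|].
      intros s3 (Ej3 & S' & r' & Hs3 & Hcov3 & Hw3) Hf3.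
      rewrite Ej3; split; [split; [lia|]|lia].
      exists S', r'; split; [auto|split; [auto|]].
      replace (n - (s2 r_j 0 + 1)) with (n - s2 r_j 0 - 1) by lia.
      rewrite (Hf2 21), (Hf1 21) in Hw3 by reflexivity.
      intros HW; apply Hw3.
      replace (Datatypes.S (n - s2 r_j 0 - 1)) with (n - s2 r_j 0) by lia; auto.
  - rewrite Ej1; nia.
  - intros s2 [(Hj & S & r & Hs2 & Hcov & Hw) He] Hf2.
    pose proof Hs2 as (Hb2 & _ & HS2 & HC2 & _).
    assert (En : s2 r_n 0 = n) by apply Hb2.
    ss in He; rewrite En in He.
    replace (s2 r_j 0) with n in Hcov, Hw by lia.
    eapply run_conseq; [now apply (c_verify_spec s2 S)|auto|].
    intros s3 Hv Hf3; exists S; split; [now apply covers_complete|].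
    rewrite Nat.sub_diag in Hw; split; [exact Hw|].
    assert (E : forall a, In a [r_empty; r_2k; r_ans] -> s2 a 0 = s a 0).
    { intros a Ha; simpl in Ha.
      repeat (destruct Ha as [<-|Ha]; [now rewrite Hf2, Hf1|]); easy. }
    rewrite !E in Hv by (simpl; auto); exact Hv.
Qed.

End Network.

(** * From formulas to networks *)

Definition clause_arcs (c : clause) : list (nat * nat) :=
  match c with
  | [] => []
  | [a] => [(neg (enc_lit a), enc_lit a); (neg (enc_lit a), enc_lit a)]
  | a :: b :: _ => [(neg (enc_lit a), enc_lit b); (neg (enc_lit b), enc_lit a)]
  end.

Definition arcs (F : cnf) : list (nat * nat) := flat_map clause_arcs F.

(** An empty clause is violated by every assignment and counts 2, as much as the arcs of any other
    violated clause. *)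
Definition deficit (F : cnf) : nat :=
  list_sum (map (fun c : clause => match c with [] => 2 | _ => 0 end) F).

Definition cut_sum (l : list (nat * nat)) (A : nat -> bool) : nat :=
  list_sum (map (fun p => Nat.b2n (A (fst p) && negb (A (snd p)))) l).

Definition arc_tail (l : list (nat * nat)) (j : nat) : nat := fst (nth j l (0, 0)).
Definition arc_head (l : list (nat * nat)) (j : nat) : nat := snd (nth j l (0, 0)).

Lemma out_cut_sum l A : out (arc_tail l) (arc_head l) (length l) A = cut_sum l A.
Proof.
  induction l as [|p l IH] using rev_ind; [reflexivity|].
  unfold cut_sum; rewrite map_app, list_sum_app; fold (cut_sum l A).
  rewrite length_app, Nat.add_1_r; cbn [out]; rewrite <- IH; f_equal.
  - apply out_ext; intros j Hj; unfold arc_tail, arc_head; now rewrite app_nth1.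
  - unfold arc_tail, arc_head; rewrite app_nth2, Nat.sub_diag by auto; simpl; lia.
Qed.

Lemma node_arcs l x :
  node (arc_tail l) (arc_head l) (length l) x <-> exists p, In p l /\ (x = fst p \/ x = snd p).
Proof.
  split.
  - intros (j & Hj & Hx); exists (nth j l (0, 0)); split; [now apply nth_In|exact Hx].
  - intros (p & Hp & Hx).
    destruct (In_nth l p (0, 0) Hp) as (j & Hj & <-); exists j; auto.
Qed.

Lemma enc_lit_true v : enc_lit (true, v) = 2 * v + 2.
Proof. unfold enc_lit; simpl; lia. Qed.

Lemma enc_lit_false v : enc_lit (false, v) = 2 * v + 1.
Proof. unfold enc_lit; simpl; lia. Qed.

Lemma neg_enc_lit b v : neg (enc_lit (b, v)) = enc_lit (negb b, v).
Proof.
  destruct b; unfold negb; rewrite enc_lit_true, enc_lit_false; unfold neg.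
  - replace (2 * v + 2) with (2 * (v + 1)) by lia.
    rewrite Nat.even_mul; simpl; lia.
  - replace (2 * v + 1) with (S (2 * v)) by lia.
    rewrite Nat.even_succ, <- Nat.negb_even, Nat.even_mul; simpl; lia.
Qed.

Lemma clause_arcs_lit c p :
  In p (clause_arcs c) -> exists a b, In a c /\ In b c /\ p = (neg (enc_lit a), enc_lit b).
Proof.
  destruct c as [|a [|b c]]; simpl; [easy| |]; intros [<-|[<-|[]]]; eauto 9.
Qed.

Lemma clause_arcs_neg c p q : In (p, q) (clause_arcs c) -> In (neg q, neg p) (clause_arcs c).
Proof.
  destruct c as [|a [|b c]]; simpl; [easy| |]; intros [[= <- <-]|[[= <- <-]|[]]];
    rewrite neg_neg; auto.
Qed.

Lemma arcs_neg F p q : In (p, q) (arcs F) -> In (neg q, neg p) (arcs F).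
Proof.
  unfold arcs; rewrite !in_flat_map; intros (c & Hc & Hp).
  exists c; split; auto; now apply clause_arcs_neg.
Qed.

Lemma enc_lit_pos a : enc_lit a <> 0.
Proof. unfold enc_lit; lia. Qed.

Lemma neg_enc_lit_pos a : neg (enc_lit a) <> 0.
Proof. destruct a; rewrite neg_enc_lit; apply enc_lit_pos. Qed.

(** * Implication graphs are skew-symmetric networks *)

Section Formula.

Variable F : cnf.

Notation fnode := (node (arc_tail (arcs F)) (arc_head (arcs F)) (length (arcs F))).

Lemma fnode_pos x : fnode x -> x <> 0.
Proof.
  rewrite node_arcs; intros (p & Hp & Hx); unfold arcs in Hp.
  apply in_flat_map in Hp as (c & _ & Hp).
  destruct (clause_arcs_lit c p Hp) as (a & b & _ & _ & ->).
  destruct Hx as [-> | ->]; [apply neg_enc_lit_pos|apply enc_lit_pos].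
Qed.

Lemma fnode_neg x : fnode x -> fnode (neg x).
Proof.
  rewrite !node_arcs; intros ([p q] & Hp & Hx).
  apply arcs_neg in Hp; exists (neg q, neg p); split; auto.
  destruct Hx as [-> | ->]; auto.
Qed.

Lemma fnode_lit x : fnode x ->
  exists j, j < length (arcs F) /\ (x = arc_head (arcs F) j \/ x = neg (arc_head (arcs F) j)).
Proof.
  rewrite node_arcs; intros ([p q] & Hp & Hx).
  destruct Hx as [-> | ->].
  - apply arcs_neg in Hp; destruct (In_nth _ _ (0, 0) Hp) as (j & Hj & E).
    exists j; split; auto; right; unfold arc_head; rewrite E; simpl; now rewrite neg_neg.
  - destruct (In_nth _ _ (0, 0) Hp) as (j & Hj & E).
    exists j; split; auto; left; unfold arc_head; now rewrite E.
Qed.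

(** Passing to the complement of the negation exchanges the contributions of the two arcs of each
    clause. *)
Lemma fcut_neg A :
  out (arc_tail (arcs F)) (arc_head (arcs F)) (length (arcs F)) (fun x => negb (A (neg x))) =
  out (arc_tail (arcs F)) (arc_head (arcs F)) (length (arcs F)) A.
Proof.
  rewrite !out_cut_sum; unfold cut_sum, arcs.
  induction F as [|c F' IH]; [reflexivity|].
  simpl flat_map; rewrite !map_app, !list_sum_app, IH; f_equal.
  destruct c as [|a [|b c]]; simpl; auto; rewrite !neg_neg.
  - destruct (A (neg (enc_lit a))), (A (enc_lit a)); auto.
  - destruct (A (neg (enc_lit a))), (A (enc_lit a)),
      (A (neg (enc_lit b))), (A (enc_lit b)); auto.
Qed.

End Formula.

(** * Deleted clauses, violated clauses and cuts *)

Definition lit_val (a : nat -> bool) (l : literal) : bool := Bool.eqb (a (snd l)) (fst l).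
Definition clause_val (a : nat -> bool) (c : clause) : bool := existsb (lit_val a) c.
Definition unsat_count (a : nat -> bool) (F : cnf) : nat :=
  length (filter (fun c => negb (clause_val a c)) F).

Lemma clause_val_sat a c : clause_val a c = true <-> clause_sat a c.
Proof.
  unfold clause_val, clause_sat; rewrite existsb_exists, Exists_exists.
  unfold lit_val, lit_true; split; intros (l & Hl & H); exists l; split; auto;
    now apply Bool.eqb_true_iff.
Qed.

Definition unsat_indices (a : nat -> bool) (l : list (nat * clause)) : list nat :=
  map fst (filter (fun ic => negb (clause_val a (snd ic))) l).

Lemma map_fst_combine_seq (F : cnf) : forall s,
  map fst (combine (seq s (length F)) F) = seq s (length F).
Proof. induction F as [|c F IH]; intros s; simpl; f_equal; auto. Qed.

Lemma unsat_indices_length a F : forall s,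
  length (unsat_indices a (combine (seq s (length F)) F)) = unsat_count a F.
Proof.
  unfold unsat_indices, unsat_count; induction F as [|c F IH]; intros s; simpl; auto.
  destruct (clause_val a c); simpl; auto.
Qed.

Lemma unsat_indices_nodup a l : NoDup (map fst l) -> NoDup (unsat_indices a l).
Proof.
  unfold unsat_indices; induction l as [|[i c] l IH]; simpl; intros H; [constructor|].
  inversion_clear H as [|? ? Hi Hl].
  destruct (negb _); simpl; auto; constructor; auto.
  intros Hin; apply Hi.
  apply in_map_iff in Hin as (p & <- & Hp); apply filter_In in Hp as [Hp _].
  now apply in_map.
Qed.

(** For a fixed assignment, the indices of the violated clauses lie in every deletion set that
    works, and they form one themselves. *)
Lemma del_sat_iff F k : del_sat F k <-> exists a, unsat_count a F <= k.
Proof.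
  set (l := combine (seq 0 (length F)) F).
  assert (HND : forall a, NoDup (unsat_indices a l)).
  { intros a; apply unsat_indices_nodup; unfold l; rewrite map_fst_combine_seq.
    apply seq_NoDup. }
  assert (Hin : forall a i, In i (unsat_indices a l) <->
    exists c, In (i, c) l /\ clause_val a c = false).
  { intros a i; unfold unsat_indices; rewrite in_map_iff; split.
    - intros ([j c] & <- & Hp); apply filter_In in Hp as [Hp E].
      exists c; split; auto; now apply negb_true_iff in E.
    - intros (c & Hp & E); exists (i, c); rewrite filter_In; simpl; now rewrite E. }
  split.
  - intros (S & _ & _ & HS & a & Ha); exists a.
    rewrite <- (unsat_indices_length a F 0); fold l.
    apply Nat.le_trans with (length S); auto.
    apply NoDup_incl_length; auto; intros i Hi.
    apply Hin in Hi as (c & Hp & E).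
    destruct (existsb (Nat.eqb i) S) eqn:Ei.
    + apply existsb_exists in Ei as (j & Hj & Ej); apply Nat.eqb_eq in Ej; now subst.
    + exfalso; rewrite Forall_forall in Ha.
      specialize (Ha c); rewrite <- clause_val_sat, E in Ha.
      discriminate Ha; unfold delete_clauses; fold l.
      apply in_map_iff; exists (i, c); rewrite filter_In; simpl; rewrite Ei; auto.
  - intros (a & Ha); exists (unsat_indices a l); split; [auto|split; [|split]].
    + apply Forall_forall; intros i Hi; apply Hin in Hi as (c & Hp & _).
      apply in_combine_l in Hp; apply in_seq in Hp; lia.
    + unfold l; now rewrite unsat_indices_length.
    + exists a; apply Forall_forall; intros c Hc; unfold delete_clauses in Hc; fold l in Hc.
      apply in_map_iff in Hc as ([i c'] & E & Hp); simpl in E; subst c'.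
      apply filter_In in Hp as [Hp Hi]; simpl in Hi.
      apply clause_val_sat; destruct (clause_val a c) eqn:E; auto.
      apply negb_true_iff in Hi; assert (Hi' : In i (unsat_indices a l)) by (apply Hin; eauto).
      rewrite <- Hi; apply existsb_exists; exists i; split; auto.
      apply Nat.eqb_refl.
Qed.

(** By truth tables, both arcs of a violated clause leave Y and no arc of a satisfied one does. *)
Lemma cut_unsat_count a Y F :
  is_2cnf F ->
  (forall c l, In c F -> In l c ->
     Y (enc_lit l) = lit_val a l /\ Y (neg (enc_lit l)) = negb (lit_val a l)) ->
  cut_sum (arcs F) Y + deficit F = 2 * unsat_count a F.
Proof.
  intros H2 HY; unfold cut_sum, arcs, deficit, unsat_count.
  induction F as [|c F IH]; [reflexivity|].
  inversion_clear H2 as [|? ? Hc HF].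
  simpl flat_map; rewrite map_app, list_sum_app; simpl map at 2; simpl filter.
  assert (IH' := IH HF (fun c' l Hc' Hl => HY c' l (or_intror Hc') Hl)).
  assert (Hcl : forall l, In l c ->
     Y (enc_lit l) = lit_val a l /\ Y (neg (enc_lit l)) = negb (lit_val a l))
    by (intros l Hl; apply (HY c); simpl; auto).
  cbn [list_sum fold_right].
  enough (E : list_sum (map (fun p => Nat.b2n (Y (fst p) && negb (Y (snd p)))) (clause_arcs c))
    + match c with [] => 2 | _ => 0 end = if clause_val a c then 0 else 2).
  { fold list_sum in *; unfold list_sum in *.
    destruct (clause_val a c); simpl length; simpl; lia. }
  destruct c as [|l1 [|l2 [|l3 c]]]; simpl in Hc; try lia; simpl.
  - reflexivity.
  - destruct (Hcl l1) as [-> ->]; simpl; auto; now destruct (lit_val a l1).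
  - destruct (Hcl l1) as [-> ->]; simpl; auto; destruct (Hcl l2) as [-> ->]; simpl; auto.
    now destruct (lit_val a l1), (lit_val a l2).
Qed.

Lemma in_clause_arcs c l : length c <= 2 -> In l c ->
  exists p, In p (clause_arcs c) /\ snd p = enc_lit l.
Proof.
  destruct c as [|l1 [|l2 [|l3 c]]]; simpl; try lia; intros _ H.
  - destruct H as [<-|[]]; eexists; split; [now left|reflexivity].
  - destruct H as [<-|[<-|[]]];
      [exists (neg (enc_lit l2), enc_lit l1)|exists (neg (enc_lit l1), enc_lit l2)]; auto.
Qed.

Lemma complete_cut_iff F k : is_2cnf F ->
  (exists Y, complete (arc_tail (arcs F)) (arc_head (arcs F)) (length (arcs F)) Y /\
     out (arc_tail (arcs F)) (arc_head (arcs F)) (length (arcs F)) Y + deficit F <= k + k) <->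
  del_sat F k.
Proof.
  intros H2; rewrite del_sat_iff; split.
  (* [2 * v + 2] is the code of the positive literal of v. *)
  - intros (Y & HY & Hc); exists (fun v => Y (2 * v + 2)).
    rewrite out_cut_sum, (cut_unsat_count (fun v => Y (2 * v + 2)) Y F) in Hc; auto; [lia|].
    intros c [b v] Hcl Hl.
    assert (HYl : Y (neg (enc_lit (b, v))) = negb (Y (enc_lit (b, v)))).
    { apply HY, node_arcs; unfold is_2cnf in H2; rewrite Forall_forall in H2.
      destruct (in_clause_arcs c (b, v) (H2 c Hcl) Hl) as (p & Hp & E).
      exists p; split; auto; unfold arcs; apply in_flat_map; eauto. }
    rewrite HYl; unfold lit_val; cbn [fst snd]; rewrite <- enc_lit_true.
    destruct b; [now destruct (Y (enc_lit (true, v)))|].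
    rewrite neg_enc_lit in HYl; cbn [negb] in HYl; rewrite HYl.
    now destruct (Y (enc_lit (false, v))).
  - intros (a & Ha).
    (* Both codes x of a variable v satisfy [(x - 1) / 2 = v], and the even one is positive. *)
    set (Y := fun x => if Nat.even x then a ((x - 1) / 2) else negb (a ((x - 1) / 2))).
    assert (HYl : forall l, Y (enc_lit l) = lit_val a l).
    { intros [[|] v]; unfold Y, lit_val; cbn [fst snd].
      - rewrite enc_lit_true; replace (2 * v + 2) with (2 * (v + 1)) by lia.
        rewrite Nat.even_mul; cbn [Nat.even orb].
        replace (2 * (v + 1) - 1) with (1 + v * 2) by lia.
        rewrite Nat.div_add by lia; simpl; now destruct (a v).
      - rewrite enc_lit_false; replace (2 * v + 1) with (S (2 * v)) by lia.
        rewrite Nat.even_succ, <- Nat.negb_even, Nat.even_mul; cbn [Nat.even orb negb].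
        replace (S (2 * v) - 1) with (v * 2) by lia.
        rewrite Nat.div_mul by lia; now destruct (a v). }
    assert (HYn : forall l, Y (neg (enc_lit l)) = negb (lit_val a l)).
    { intros [b v]; rewrite neg_enc_lit, HYl; unfold lit_val; simpl.
      now destruct b, (a v). }
    exists Y; split.
    + intros x Hx; apply node_arcs in Hx as (p & Hp & Hx).
      unfold arcs in Hp; apply in_flat_map in Hp as (c & _ & Hp).
      destruct (clause_arcs_lit c p Hp) as (l & l' & _ & _ & ->).
      destruct Hx as [-> | ->]; cbn [fst snd]; rewrite ?neg_neg, HYl, HYn; auto.
      now rewrite negb_involutive.
    + rewrite out_cut_sum, (cut_unsat_count a Y F); auto; lia.
Qed.

(** * The whole program *)

(** In the second loop the remainder is [x * 2 ^ i] modulo [2 ^ (e + 1)], with an existential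
    quotient instead of a division. At [i = e] it is [2 ^ e] times the parity of x. *)
Lemma c_neg_spec s x : s r_in 0 = x ->
  run c_neg s (20 * bitlen x) (fun s' => s' r_out 0 = neg x).
Proof.
  intros Ex; unfold bitlen.
  apply run_put_seq; [lia|].
  eapply run_seq with (T1 := 2 * Nat.log2 x + 3) (T2 := 15 * S (Nat.log2 x)); [|lia|].
  - apply run_while with
      (I := fun s1 => exists e, e <= Nat.log2 x /\ s1 r_pow 0 = 2 ^ (e + 1))
      (mu := fun s1 => Nat.log2 x + 1 - Nat.log2 (s1 r_pow 0)) (B := 1).
    + exists 0; ss; split; [lia|reflexivity].
    + ss; lia.
    + intros s1 (e & He & E) Hf Hc.
      assert (Ex1 : s1 r_in 0 = x) by (rewrite Hf by reflexivity; exact Ex).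
      ss in Hc; rewrite E, Ex1 in Hc.
      assert (Hle : 2 ^ (e + 1) <= x) by lia.
      assert (Hx : 0 < x) by (pose proof (Nat.pow_nonzero 2 (e + 1)); lia).
      apply (Nat.log2_le_pow2 x (e + 1) Hx) in Hle.
      apply run_put; [lia|]; ss; rewrite E.
      replace (2 ^ (e + 1) + 2 ^ (e + 1)) with (2 ^ (e + 1 + 1))
        by (rewrite (Nat.pow_add_r 2 (e + 1) 1), Nat.pow_1_r; lia).
      rewrite !Nat.log2_pow2 by lia; split; [|lia].
      exists (e + 1); split; [lia|reflexivity].
  - intros s1 [(e & He & E) Hc] Hf1.
    assert (Ex1 : s1 r_in 0 = x) by now rewrite Hf1.
    ss in Hc; rewrite E, Ex1 in Hc.
    do 2 (apply run_put_seq; [lia|]); ss.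
    eapply run_seq with (T1 := 5 * e + 1) (T2 := 2); [|lia|].
    + apply run_while with
        (I := fun s2 => exists i c, i <= e /\ s2 r_pow' 0 = 2 ^ (i + 1) /\
           s2 r_rem 0 < 2 ^ (e + 1) /\ x * 2 ^ i = c * 2 ^ (e + 1) + s2 r_rem 0)
        (mu := fun s2 => e + 1 - Nat.log2 (s2 r_pow' 0)) (B := 4).
      * exists 0, 0; ss; rewrite Ex1, Nat.pow_0_r; repeat split; lia.
      * ss; change (Nat.log2 2) with 1; lia.
      * intros s2 (i & c & Hi & Eg & Hy & Ey) Hf2 Hc2.
        assert (EP : s2 r_pow 0 = 2 ^ (e + 1)) by (rewrite Hf2 by reflexivity; exact E).
        ss in Hc2; rewrite EP, Eg in Hc2.
        assert (Hie : i < e).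
        { destruct (Nat.eq_dec i e) as [->|]; lia. }
        apply run_put_seq; [lia|]; ss.
        set (y := s2 32 0) in *.
        apply run_seq with (T1 := 2) (T2 := 1)
          (Q1 := fun s3 => s3 r_rem 0 < 2 ^ (e + 1) /\
             exists c, x * 2 ^ (i + 1) = c * 2 ^ (e + 1) + s3 r_rem 0); [|lia|].
        -- assert (Ep : x * 2 ^ (i + 1) = 2 * c * 2 ^ (e + 1) + (y + y))
             by (rewrite (Nat.pow_add_r 2 i 1), Nat.pow_1_r; nia).
           apply run_if; [lia| |]; ss; rewrite EP; intros Hc3.
           ++ apply run_put; [lia|]; ss; rewrite EP; split; [lia|].
              exists (2 * c + 1); lia.
           ++ apply run_skip; ss; split; [lia|].
              exists (2 * c); lia.
        -- intros s3 (Hy3 & c3 & Ec3) Hf3; apply run_put; [lia|]; ss.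
           rewrite (Hf3 31) by reflexivity; ss; rewrite Eg.
           replace (2 ^ (i + 1) + 2 ^ (i + 1)) with (2 ^ (i + 1 + 1))
             by (rewrite (Nat.pow_add_r 2 (i + 1) 1), Nat.pow_1_r; lia).
           rewrite !Nat.log2_pow2 by lia; split; [|lia].
           exists (i + 1), c3; repeat split; auto; lia.
    + intros s2 [(i & c & Hi & Eg & Hy & Ey) Hc2] Hf2.
      assert (EP : s2 r_pow 0 = 2 ^ (e + 1)) by (rewrite Hf2 by reflexivity; exact E).
      assert (Ex2 : s2 r_in 0 = x) by (rewrite Hf2 by reflexivity; exact Ex1).
      ss in Hc2; rewrite EP, Eg in Hc2.
      assert (i = e) as ->.
      { destruct (Nat.eq_dec i e); auto; exfalso.
        assert (2 ^ (i + 1) < 2 ^ (e + 1)) by (apply Nat.pow_lt_mono_r; lia); lia. }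
      rewrite Nat.pow_add_r, Nat.pow_1_r in Hy, Ey.
      pose proof (Nat.pow_nonzero 2 e).
      set (p := 2 ^ e) in *; set (y := s2 32 0) in *.
      assert (Hodd : y = 0 <-> Nat.even x = true).
      { rewrite Nat.even_spec; split.
        - intros Hy0; exists c; nia.
        - intros (z & ->).
          assert (z = c) by nia; subst z; nia. }
      apply run_if; [lia| |]; ss; fold y; intros Hy0; apply run_put; try lia; ss;
        rewrite Ex2; unfold neg.
      * destruct (Nat.even x); [exfalso; apply Hy0; now apply Hodd|lia].
      * rewrite (proj1 Hodd) by auto; lia.
Qed.

Definition lit1 (c : clause) : nat := nth 0 (map enc_lit c) 0.
Definition lit2 (c : clause) : nat := nth 1 (map enc_lit c) 0.

(** The two header cells occupy position 0 of the input arrays, so the literals of clause i are at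
    position i + 1. *)
Definition input (s : env) (F : cnf) (k : nat) : Prop :=
  s 0 0 = k /\ s 1 0 = length F /\
  (forall i, i < length F -> s 0 (i + 1) = lit1 (nth i F []) /\ s 1 (i + 1) = lit2 (nth i F [])).

(** Convertible to [base] for the network with arc list [l], so the results on attempts apply
    directly. *)
Definition built (s : env) (l : list (nat * nat)) : Prop :=
  s r_n 0 = length l /\
  (forall j, j < length l -> s a_otail j = arc_tail l j /\ s a_ohead j = arc_head l j) /\
  (forall x, node (arc_tail l) (arc_head l) (length l) x -> s a_neg x = neg x).

Lemma nth_pair (l : list (nat * nat)) p q j :
  nth j (l ++ [p; q]) (0, 0) =
  if j <? length l then nth j l (0, 0) else if j =? length l then p
  else if j =? length l + 1 then q else (0, 0).
Proof.
  destruct (Nat.ltb_spec j (length l)); [now apply app_nth1|].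
  rewrite app_nth2 by auto.
  destruct (Nat.eqb_spec j (length l)) as [->|]; [now rewrite Nat.sub_diag|].
  destruct (Nat.eqb_spec j (length l + 1)) as [->|].
  - now replace (length l + 1 - length l) with 1 by lia.
  - destruct (j - length l) as [|[|j']] eqn:E; try lia; now destruct j'.
Qed.

Lemma c_clause_spec s l c Z :
  length c <= 2 -> (forall a, In a c -> bitlen (enc_lit a) <= Z) -> 1 <= Z ->
  built s l -> s 0 (s r_j 0 + 1) = lit1 c -> s 1 (s r_j 0 + 1) = lit2 c ->
  run c_clause s (70 * Z) (fun s' => s' r_j 0 = s r_j 0 + 1 /\
    built s' (l ++ clause_arcs c) /\
    s' r_empty 0 = s r_empty 0 + match c with [] => 2 | _ => 0 end).
Proof.
  intros Hc HZ HZ1 Hb E1 E2.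
  do 2 (apply run_put_seq; [lia|]); ss; rewrite E1, E2.
  apply run_seq with (T1 := 65 * Z) (T2 := 1)
    (Q1 := fun s' => built s' (l ++ clause_arcs c) /\
      s' r_empty 0 = s r_empty 0 + match c with [] => 2 | _ => 0 end); [|lia|].
  2:{ intros s1 [Hb1 Ee] Hf1; apply run_put; [lia|]; ss.
      rewrite (Hf1 19) by reflexivity; ss; split; [reflexivity|split; [exact Hb1|exact Ee]]. }
  apply run_if; [lia| |]; ss; intros Ha.
  2:{ destruct c as [|a c]; [|exfalso; now apply (enc_lit_pos a)].
      apply run_put; [lia|]; ss; split; [|reflexivity].
      simpl; rewrite app_nil_r; exact Hb. }
  (* Unit and binary clauses are unified here, with [b = a] for a unit clause, whose second code is
     the padding 0. *)
  assert (Hab : exists a b, In a c /\ In b c /\ lit1 c = enc_lit a /\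
      (if lit2 c =? 0 then lit1 c else lit2 c) = enc_lit b /\
      clause_arcs c = [(neg (enc_lit a), enc_lit b); (neg (enc_lit b), enc_lit a)] /\
      match c with [] => 2 | _ => 0 end = 0).
  { destruct c as [|a [|b [|d c]]]; simpl in Hc; try lia; [easy| |].
    - exists a, a; simpl; auto 10.
    - exists a, b; unfold lit2; cbn [map nth].
      rewrite (proj2 (Nat.eqb_neq _ _) (enc_lit_pos b)); simpl; auto 10. }
  destruct Hab as (a & b & Hina & Hinb & Ea & Eb & -> & ->).
  set (x := enc_lit a) in *; set (y := enc_lit b) in *.
  rewrite Ea in *.
  eapply run_seq with (T1 := 2) (T2 := 60 * Z)
    (Q1 := fun s' => s' r_a 0 = x /\ s' r_b 0 = y); [|lia|].
  { apply run_if; [lia| |]; ss; intros Hl2.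
    - apply run_skip; ss; split; auto.
      now rewrite (proj2 (Nat.eqb_neq _ _) Hl2) in Eb.
    - apply run_put; [lia|]; ss; split; auto.
      now rewrite (proj2 (Nat.eqb_eq _ _) Hl2) in Eb. }
  intros s1 [Ex Ey] Hf1.
  apply run_put_seq; [lia|]; ss.
  eapply run_seq with (T2 := 39 * Z); [apply (c_neg_spec _ x); exact Ex| |].
  { specialize (HZ a Hina); fold x in HZ; lia. }
  intros s2 Hna Hf2.
  do 2 (apply run_put_seq; [lia|]); ss.
  assert (Ey2 : s2 r_b 0 = y) by (rewrite Hf2 by reflexivity; exact Ey).
  eapply run_seq with (T2 := 10); [apply (c_neg_spec _ y); exact Ey2| |].
  { specialize (HZ b Hinb); fold y in HZ; lia. }
  intros s3 Hnb Hf3.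
  assert (Ea3 : s3 r_a 0 = x)
    by (rewrite Hf3 by reflexivity; ss; rewrite Hf2 by reflexivity; exact Ex).
  assert (Eb3 : s3 r_b 0 = y) by (rewrite Hf3 by reflexivity; exact Ey2).
  assert (Ena : s3 r_na 0 = neg x) by (rewrite Hf3 by reflexivity; exact Hna).
  assert (Fr : forall d, In d [4; 5; 8; 10; 11] -> forall i, s3 d i = s d i).
  { intros d Hd i; simpl in Hd.
    repeat (destruct Hd as [<-|Hd];
      [rewrite Hf3 by reflexivity; ss; rewrite Hf2 by reflexivity; ss;
       now rewrite Hf1|]); easy. }
  destruct Hb as (Hn & Hth & Hneg).
  assert (En3 : s3 r_n 0 = length l) by (rewrite Fr by (simpl; tauto); exact Hn).
  apply run_put_seq; [lia|]; ss; rewrite Hnb.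
  do 8 (apply run_put_seq; [lia|]; ss; rewrite ?Ea3, ?Eb3, ?Ena, ?En3).
  apply run_put; [lia|]; ss; rewrite En3, (Fr 11) by (simpl; tauto).
  split; [|lia]; unfold built; ss.
  rewrite length_app; split; [reflexivity|split].
  - intros j Hj; unfold arc_tail, arc_head; rewrite !nth_pair; simpl in Hj.
    rewrite (Fr 4), (Fr 5) by (simpl; tauto).
    destruct (Nat.eqb_spec j (length l)) as [->|Hne1].
    + rewrite Nat.ltb_irrefl.
      destruct (Nat.eqb_spec (length l) (length l + 1)); [lia|auto].
    + destruct (Nat.eqb_spec j (length l + 1)) as [->|Hne2].
      * destruct (Nat.ltb_spec (length l + 1) (length l)); [lia|auto].
      * destruct (Nat.ltb_spec j (length l)); [|lia].
        now apply Hth.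
  - intros z Hz; rewrite <- length_app in Hz; apply node_arcs in Hz as (p & Hp & Hz).
    (* All four table entries written are correct negations, so coincidences between them do no
       harm. *)
    repeat match goal with |- context [z =? ?t] => destruct (Nat.eqb_spec z t) as [->|] end;
      rewrite ?neg_neg; auto.
    rewrite Fr by (simpl; tauto).
    apply in_app_or in Hp as [Hp|[<-|[<-|[]]]]; [apply Hneg, node_arcs; eauto| |];
      destruct Hz; contradiction.
Qed.

Lemma firstn_succ {A} (d : A) l : forall j, j < length l ->
  firstn (j + 1) l = firstn j l ++ [nth j l d].
Proof.
  induction l as [|x l IH]; intros [|j] Hj; simpl in *; try lia; auto.
  now rewrite IH by lia.
Qed.

Lemma c_build_spec s F k Z :
  is_2cnf F -> (forall c a, In c F -> In a c -> bitlen (enc_lit a) <= Z) -> 1 <= Z ->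
  input s F k ->
  run c_build s (length F * (70 * Z + 1) + 4) (fun s' =>
    built s' (arcs F) /\ s' r_empty 0 = deficit F).
Proof.
  intros H2 HZ HZ1 (Hk & Hm & Hin).
  do 3 (apply run_put_seq; [lia|]).
  eapply run_conseq.
  - apply run_while with
      (I := fun s1 => s1 r_j 0 <= length F /\ built s1 (arcs (firstn (s1 r_j 0) F)) /\
         s1 r_empty 0 = deficit (firstn (s1 r_j 0) F))
      (mu := fun s1 => length F - s1 r_j 0) (B := 70 * Z).
    + ss; split; [lia|split; [|reflexivity]].
      split; [reflexivity|split; [simpl; lia|]].
      intros x (j & Hj & _); simpl in Hj; lia.
    + apply Nat.le_refl.
    + intros s1 (Hj & Hb & He) Hf Hc.
      ss in Hc; rewrite (Hf 1) in Hc by reflexivity; ss in Hc; rewrite Hm in Hc.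
      set (j := s1 r_j 0) in *.
      assert (Hlt : j < length F) by lia.
      assert (HinF : In (nth j F []) F) by now apply nth_In.
      destruct (Hin j Hlt) as [E1 E2].
      assert (Ei : forall a, In a [0; 1] -> forall i, s1 a i = s a i).
      { intros a Ha i; simpl in Ha.
        repeat (destruct Ha as [<-|Ha]; [now rewrite Hf|]); easy. }
      eapply run_conseq; [apply (c_clause_spec s1 (arcs (firstn j F)) (nth j F []) Z); auto|auto|].
      * unfold is_2cnf in H2; rewrite Forall_forall in H2; auto.
      * intros a; now apply HZ.
      * fold j; rewrite Ei by (simpl; auto); exact E1.
      * fold j; rewrite Ei by (simpl; auto); exact E2.
      * intros s2 (Ej2 & Hb2 & He2) _; rewrite Ej2; fold j.
        split; [split; [lia|]|lia].
        rewrite (@firstn_succ clause []) by auto; unfold arcs, deficit.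
        rewrite flat_map_app, map_app, list_sum_app.
        split; [simpl; rewrite app_nil_r; exact Hb2|].
        rewrite He2, He; unfold deficit; f_equal; unfold list_sum; cbn [map fold_right]; lia.
  - ss; rewrite Nat.sub_0_r; nia.
  - intros s1 [(Hj & Hb & He) Hc] Hf.
    ss in Hc; rewrite (Hf 1) in Hc by reflexivity; ss in Hc; rewrite Hm in Hc.
    rewrite firstn_all2 in Hb, He by lia; auto.
Qed.

Lemma arcs_length F : length (arcs F) <= 2 * length F.
Proof.
  unfold arcs; induction F as [|c F IH]; simpl; auto.
  rewrite length_app; destruct c as [|a [|b c]]; simpl; lia.
Qed.

Lemma c_attempt_built F budget s : built s (arcs F) ->
  run c_attempt s (200 * sqr_succ_n (length (arcs F)) * (length (arcs F) + 1)) (fun s' =>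
    let cut := out (arc_tail (arcs F)) (arc_head (arcs F)) (length (arcs F)) in
    exists Y, complete (arc_tail (arcs F)) (arc_head (arcs F)) (length (arcs F)) Y /\
      (wins (arc_tail (arcs F)) (arc_head (arcs F)) (length (arcs F))
         (s r_half 0) budget (length (arcs F)) 0 (fun _ => false) 0 (s r_w 0) ->
       cut Y <= budget) /\
      ((cut Y + s r_empty 0 <= s r_2k 0 /\ s' r_ans 0 = 1) \/
       (s r_2k 0 < cut Y + s r_empty 0 /\ s' r_ans 0 = s r_ans 0))).
Proof.
  apply c_attempt_spec.
  - apply fnode_pos.
  - apply fnode_neg.
  - apply fnode_lit.
  - apply fcut_neg.
Qed.

Lemma winning_word F D budget Y : budget <= D ->
  complete (arc_tail (arcs F)) (arc_head (arcs F)) (length (arcs F)) Y ->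
  out (arc_tail (arcs F)) (arc_head (arcs F)) (length (arcs F)) Y <= budget ->
  exists w, w < 2 * 2 ^ D /\
    wins (arc_tail (arcs F)) (arc_head (arcs F)) (length (arcs F))
      (2 ^ D) budget (length (arcs F)) 0 (fun _ => false) 0 w.
Proof.
  intros HD HY Hc.
  destruct (wins_exists _ _ _ (fnode_neg F) (fnode_lit F) (fcut_neg F) D budget
    (length (arcs F)) HD 0 (fun _ => false) 0 Y) as (q & Hq & Hw); auto.
  - intros A _; lia.
  - intros x _ H; discriminate.
  - intros i Hi; lia.
  - intros x _ H; discriminate.
  - eauto.
Qed.

Lemma c_main_spec F k s Z :
  is_2cnf F -> (forall c a, In c F -> In a c -> bitlen (enc_lit a) <= Z) -> 1 <= Z ->
  length F <= Z -> input s F k ->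
  run c_main s (4900 * 4 ^ k * (Z + 1) ^ 3) (fun s' => s' r_ans 0 <> 0 <-> del_sat F k).
Proof.
  intros H2 HZ HZ1 HlF Hin.
  pose proof Hin as (Hk & _ & _).
  set (n := length (arcs F)).
  set (TA := 200 * sqr_succ_n n * (n + 1)).
  (* There are at most two arcs per clause, so [n + 1 <= 2 * (Z + 1)]; its cube turns 200 into 200 *
     8. *)
  assert (HTA : TA <= 1600 * (Z + 1) ^ 3).
  { pose proof (arcs_length F); fold n in H.
    assert (Hn : n + 1 <= 2 * (Z + 1)) by lia.
    unfold TA, sqr_succ_n; simpl Nat.pow; rewrite Nat.mul_1_r.
    assert (H1 : (n + 1) * (n + 1) <= 2 * (Z + 1) * (2 * (Z + 1))) by now apply Nat.mul_le_mono.
    assert (H3 : (n + 1) * (n + 1) * (n + 1) <= 2 * (Z + 1) * (2 * (Z + 1)) * (2 * (Z + 1)))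
      by now apply Nat.mul_le_mono.
    nia. }
  set (Z3 := (Z + 1) ^ 3) in *.
  assert (HZ3 : (Z + 1) * (Z + 1) <= Z3 /\ 8 <= Z3).
  { unfold Z3; simpl Nat.pow; rewrite Nat.mul_1_r; split; nia. }
  assert (HFk : length F * (70 * Z + 1) + 4 <= 80 * Z3) by nia.
  assert (H4k : k < 4 ^ k) by (apply Nat.pow_gt_lin_r; lia).
  assert (EH : 2 ^ (k + k) = 4 ^ k)
    by (replace (k + k) with (2 * k) by lia; now rewrite Nat.pow_mul_r).
  set (K := 4 ^ k) in *.
  assert (HKZ : Z3 <= K * Z3) by nia.
  assert (HkZ : k <= K * Z3) by nia.
  eapply run_seq with (T2 := 4800 * K * Z3); [now apply (c_build_spec s F k Z)|lia|].
  intros s1 [Hb1 He1] Hf1.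
  assert (Ek : s1 0 0 = k) by now rewrite Hf1.
  do 3 (apply run_put_seq; [lia|]); ss; rewrite Ek.
  eapply run_seq with (T1 := (k + k) * 3 + 1) (T2 := 4700 * K * Z3); [|nia|].
  { apply run_while with
      (I := fun s2 => s2 r_half 0 * 2 ^ (s2 r_j 0) = 2 ^ (k + k))
      (mu := fun s2 => s2 r_j 0) (B := 2).
    - ss; lia.
    - ss; lia.
    - intros s2 E2 Hf2 Hc; ss in Hc.
      apply run_put_seq; [lia|]; apply run_put; [lia|]; ss; split; [|lia].
      rewrite <- E2; destruct (s2 19 0) as [|d]; [easy|].
      replace (S d - 1) with d by lia; rewrite Nat.pow_succ_r'; lia. }
  intros s2 [E2 Hc2] Hf2; ss in Hc2; rewrite Hc2, Nat.pow_0_r, Nat.mul_1_r, EH in E2.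
  do 2 (apply run_put_seq; [lia|]); ss; rewrite E2.
  set (s3 := put _ _ _ _).
  assert (Fr : forall s', frame (r_words ::= %r_words - 1 ;; r_w ::= %r_words ;; c_attempt) s3 s' ->
    built s' (arcs F) /\ s' r_half 0 = K /\ s' r_empty 0 = deficit F /\ s' r_2k 0 = k + k).
  { intros s' Hf'.
    assert (E : forall a, In a [4; 5; 8; 10; 11] -> forall i, s' a i = s1 a i).
    { intros a Ha i; simpl in Ha.
      repeat (destruct Ha as [<-|Ha];
        [rewrite Hf' by reflexivity; unfold s3; ss; now rewrite Hf2|]); easy. }
    split; [|split; [|split]].
    - destruct Hb1 as (B1 & B2 & B3); split; [rewrite E by (simpl; tauto); auto|split].
      + intros j Hj; rewrite !E by (simpl; tauto); auto.
      + intros x Hx; rewrite E by (simpl; tauto); auto.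
    - rewrite Hf' by reflexivity; exact E2.
    - rewrite E by (simpl; tauto); auto.
    - rewrite Hf' by reflexivity; unfold s3; ss; rewrite Hf2 by reflexivity; reflexivity. }
  (* The subtraction truncates if the empty clauses alone exceed 2k, whence the premise on
     [deficit F] in the completeness part of the loop invariant. *)
  set (budget := k + k - deficit F).
  set (win := wins (arc_tail (arcs F)) (arc_head (arcs F)) n K budget n 0 (fun _ => false) 0).
  eapply run_conseq.
  - apply run_while with
      (I := fun s4 => s4 r_words 0 <= K + K /\ (s4 r_ans 0 <> 0 -> del_sat F k) /\
         (deficit F <= k + k ->
          forall w, s4 r_words 0 <= w < K + K -> win w -> s4 r_ans 0 <> 0))
      (mu := fun s4 => s4 r_words 0) (B := TA + 2).
    + unfold s3; ss; split; [lia|split; [easy|intros; lia]].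
    + apply Nat.le_refl.
    + intros s4 (Hw & Hsound & Hcompl) Hf4 Hc4; ss in Hc4.
      destruct (Fr s4 Hf4) as (Hb4 & Eh4 & Ed4 & Ek4).
      do 2 (apply run_put_seq; [lia|]); ss.
      set (s5 := put _ _ _ _).
      assert (Hb5 : built s5 (arcs F)) by exact Hb4.
      eapply run_conseq; [apply (c_attempt_built F budget s5 Hb5)|fold n; fold TA; lia|].
      intros s6 (Y & HY & Hwin & Hans) Hf6; cbv zeta in Hwin, Hans.
      assert (Ew6 : s6 r_words 0 = s4 r_words 0 - 1) by (rewrite Hf6 by reflexivity; reflexivity).
      rewrite Ew6; split; [|lia]; split; [lia|].
      unfold s5 in Hans, Hwin; ss in Hans; ss in Hwin.
      rewrite Eh4 in Hwin; rewrite Ed4, Ek4 in Hans; fold n in Hwin, Hans.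
      split.
      * destruct Hans as [[Hle _]|[_ ->]]; [intros _|auto].
        apply complete_cut_iff; auto; eauto.
      * intros Hd w Hlt Hww.
        destruct (Nat.eq_dec w (s4 22 0 - 1)) as [->|Hne].
        -- specialize (Hwin Hww).
           destruct Hans as [[_ ->]|[Hgt _]]; [easy|]; unfold budget in Hwin; lia.
        -- destruct Hans as [[_ ->]|[_ ->]]; [easy|].
           apply (Hcompl Hd w); auto; lia.
  - unfold s3; ss; nia.
  - intros s4 [(_ & Hsound & Hcompl) Hc4] _; ss in Hc4; rewrite Hc4 in Hcompl.
    split; auto; intros Hdel.
    apply complete_cut_iff in Hdel as (Y & HY & Hle); auto.
    destruct (winning_word F (k + k) budget Y) as (w & Hw & Hwin); auto;
      try (unfold budget; fold n in Hle |- *; lia).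
    rewrite EH in Hw, Hwin; fold K in Hw.
    apply (Hcompl ltac:(lia) w); auto; lia.
Qed.

(** * Reading the encoded input, and the final program *)

Lemma nth_encode F k : forall i d, i < length F -> d < 3 ->
  nth (3 * i + d + 2) (encode F k) 0 = nth d (enc_clause (nth i F [])) 0.
Proof.
  assert (H : forall F i d, i < length F -> d < 3 ->
    nth (3 * i + d) (flat_map enc_clause F) 0 = nth d (enc_clause (nth i F [])) 0).
  { clear; intros F; assert (Hlen : forall c, length (enc_clause c) = 3)
      by (intros [|a [|b c]]; reflexivity).
    induction F as [|c F IH]; intros i d Hi Hd; [simpl in Hi; lia|].
    cbn [flat_map]; destruct i as [|i].
    - rewrite app_nth1 by (rewrite Hlen; lia); reflexivity.
    - rewrite app_nth2 by (rewrite Hlen; lia); rewrite Hlen.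
      replace (3 * S i + d - 3) with (3 * i + d) by lia.
      simpl in Hi; apply IH; lia. }
  intros i d Hi Hd; rewrite <- H by auto; unfold encode.
  replace (3 * i + d + 2) with (S (S (3 * i + d))) by lia; reflexivity.
Qed.

Lemma bitlen_input_size L x : In x L -> bitlen x <= input_size L.
Proof.
  unfold input_size; induction L as [|y L IH]; cbn [fold_right In]; [easy|].
  intros [->|Hx]; [|specialize (IH Hx)]; lia.
Qed.

Lemma length_input_size L : length L <= input_size L.
Proof.
  unfold input_size, bitlen; induction L as [|y L IH]; cbn [length fold_right]; lia.
Qed.

Lemma input_init F k : is_2cnf F -> input (fun a i => init_mem (encode F k) (addr a i)) F k.
Proof.
  intros H2; split; [reflexivity|split; [reflexivity|]].
  intros i Hi; unfold init_mem, addr; cbn [Nat.ltb Nat.leb].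
  assert (Hc : length (nth i F []) <= 2).
  { unfold is_2cnf in H2; rewrite Forall_forall in H2; apply H2, nth_In; auto. }
  replace (3 * (i + 1) + 0) with (3 * i + 1 + 2) by lia.
  replace (3 * (i + 1) + 1) with (3 * i + 2 + 2) by lia.
  rewrite !nth_encode by lia.
  destruct (nth i F []) as [|a [|b [|c l]]]; simpl in Hc; try lia; auto.
Qed.

Lemma enc_lit_in_encode F k c a :
  is_2cnf F -> In c F -> In a c -> In (enc_lit a) (encode F k).
Proof.
  intros H2 Hc Ha; right; right; apply in_flat_map; exists c; split; auto.
  unfold is_2cnf in H2; rewrite Forall_forall in H2; specialize (H2 c Hc).
  destruct c as [|x [|y [|z c]]]; simpl in H2, Ha; try lia; try easy.
  - destruct Ha as [<-|[]]; right; left; reflexivity.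
  - destruct Ha as [<-|[<-|[]]]; right; [left|right; left]; reflexivity.
Qed.

Lemma length_encode F k : length F <= length (encode F k).
Proof.
  simpl; induction F as [|c F IH]; simpl; [lia|].
  rewrite length_app; lia.
Qed.

Lemma exec_halted P t s : halted P s = true -> exec P t s = s.
Proof.
  destruct s as [pc m]; intros H; induction t as [|t IH]; simpl; auto.
  unfold halted in H; simpl in H; destruct (nth_error P pc) as [[]|]; auto; discriminate.
Qed.

Theorem mainTheorem11 :
  exists (P : program) (c d : nat),
    forall (F : cnf) (k : nat),
      is_2cnf F ->
      let L := encode F k in
      let s := exec P (c * 4 ^ k * (S (input_size L)) ^ d) (0, init_mem L) in
      halted P s = true /\ (snd s 0 <> 0 <-> del_sat F k).
Proof.
  pose (l := comp 0 c_main).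
  (* The answer is moved to cell 0, which held k; adding a zero serves as a move instruction. The
     program then halts by running past its end. *)
  pose (f := cexpr 0 (EG r_ans (EC 0)) ++ [CONST (tmp 1) 0; ADD 0 (tmp 0) (tmp 1)]).
  exists (l ++ f), (slowdown c_main * 4900 + length f), 3.
  intros F k H2 L.
  set (Z := input_size L).
  assert (Hcode : code_at (l ++ f) 0 (l ++ f)) by (intros i x Hx; exact Hx).
  apply code_at_app in Hcode as [Hl Hf].
  destruct (c_main_spec F k (fun a i => init_mem L (addr a i)) Z)
    as (t & s' & Hev & Ht & Hs'); auto.
  { intros c a Hc Ha; apply bitlen_input_size; now apply (enc_lit_in_encode F k c a). }
  { apply Nat.le_trans with (length L); [simpl; lia|apply length_input_size]. }
  { apply Nat.le_trans with (length L); [apply length_encode|apply length_input_size]. }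
  { now apply input_init. }
  destruct (comp_correct _ _ _ _ Hev (l ++ f) 0 (init_mem L)) as (t' & m & Ht' & E & Hr);
    [exact Hl|reflexivity|intros a i _; reflexivity|].
  assert (Ef : exec (l ++ f) (length f) (length l, m) =
    (length l + length f, effects f m)) by now apply exec_straight.
  assert (Eout : effects f m 0 = s' r_ans 0).
  { unfold f; rewrite effects_app.
    destruct (effects_cexpr s' (EG r_ans (EC 0)) 0 m eq_refl Hr) as (Hr1 & Hv1 & _).
    cbv zeta in Hr1, Hv1; cbn [eval] in Hv1; rewrite <- Hv1.
    unfold effects at 1; cbn [fold_left effect].
    rewrite upd_eq, upd_eq, upd_neq, Nat.add_0_r; [reflexivity|].
    intros H; now apply tmp_inj in H. }
  set (T := (slowdown c_main * 4900 + length f) * 4 ^ k * S Z ^ 3).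
  (* The statement fixes the exact number of steps; the surplus u is spent in the halted state. *)
  assert (HT : exists u, T = t' + (length f + u)).
  { assert (HX : 4 ^ k * S Z ^ 3 <> 0)
      by (apply Nat.neq_mul_0; split; apply Nat.pow_nonzero; lia).
    exists (T - (t' + length f)).
    assert (t' + length f <= T); [|lia].
    rewrite Nat.add_1_r in Ht; unfold T.
    rewrite <- Nat.mul_assoc in Ht |- *.
    set (X := 4 ^ k * S Z ^ 3) in *.
    assert (slowdown c_main * t <= slowdown c_main * (4900 * X)) by now apply Nat.mul_le_mono_l.
    rewrite Nat.mul_add_distr_r, <- Nat.mul_assoc.
    assert (length f <= length f * X) by nia.
    lia. }
  destruct HT as (u & ->).
  assert (Hh : halted (l ++ f) (length l + length f, effects f m) = true).
  { unfold halted; cbn [fst]; rewrite (proj2 (nth_error_None _ _));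
      [reflexivity|now rewrite length_app]. }
  change (0 + length (comp 0 c_main)) with (length l) in E.
  cbv zeta; rewrite !exec_add, E, Ef, exec_halted by auto.
  split; [exact Hh|cbn [snd]; rewrite Eout; exact Hs'].
Qed.
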